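(* Every full orthogonal multiplication of type $[3,4,7]$ belongs to the degenerate case $\beta=F_{14,21}=F_{14,22}=0$, and the moduli (up to domain and range equivalence) of orthogonal multiplications of type $[3,4,7]$ has dimension $1$.
   Context: An orthogonal multiplication of type $[3,4,p]$ is a bilinear map $F:\mathbb{R}^3\times\mathbb{R}^4\to\mathbb{R}^p$ with $|F(x,y)|=|x||y|$; it is full if its image spans $\mathbb{R}^p$. Domain and range equivalence means equivalence under $SO(3)\times SO(4)$ on the domain and orthogonal transformations of the range. Let $e_1,e_2,e_3$ and $f_1,\dots,f_4$ be orthonormal bases of $\mathbb{R}^3$ and $\mathbb{R}^4$, and let $F_{ij,kl}=\langle F(e_i,f_j),F(e_k,f_l)\rangle$. Up to domain equivalence the bases are chosen so that $F$ is normalized, meaning $$F_{31,12}=F_{33,14}=0,\ F_{31,22}=F_{33,24}=0,\ F_{31,23}=F_{34,22}=0,$$ $$F_{11,23}+F_{14,22}=F_{11,24}+F_{12,23}=F_{31,14}+F_{32,13}=0,$$ and $\beta=F_{31,14}$. *)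

(* Defs.v *)
From HB Require Import structures.
From mathcomp Require Import all_boot all_order all_algebra.
From mathcomp Require Import all_classical all_reals all_analysis.
Import Order.TTheory GRing.Theory Num.Theory.
Import numFieldNormedType.Exports.

Set Implicit Arguments.
Unset Strict Implicit.
Unset Printing Implicit Defensive.

Local Open Scope classical_set_scope.
Local Open Scope ring_scope.
Local Open Scope quotient_scope.
Local Open Scope card_scope.

(* The library norm on ['rV[R]_n] is the sup norm, so the Euclidean inner
   product and norm are introduced here. *)
Definition dot (R : realType) (n : nat) (u v : 'rV[R]_n) : R :=
  \sum_(i < n) u 0 i * v 0 i.

Definition enorm (R : realType) (n : nat) (u : 'rV[R]_n) : R :=
  Num.sqrt (dot u u).

Definition isO (R : realType) (n : nat) (A : 'M[R]_n) : Prop :=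
  A *m A^T = 1%:M.

Definition isSO (R : realType) (n : nat) (A : 'M[R]_n) : Prop :=
  isO A /\ \det A = 1.

(** ** Orthogonal multiplications of type [3,4,p] *)

Definition mult34 (R : realType) (p : nat) : Type :=
  'rV[R]_3 -> 'rV[R]_4 -> 'rV[R]_p.

Definition orth_mult (R : realType) (p : nat) (F : mult34 R p) : Prop :=
  bilinear_for *:%R *:%R F /\
  forall x y, enorm (F x y) = enorm x * enorm y.

(* The only linear subspace containing the image is the whole space. *)
Definition full (R : realType) (p : nat) (F : mult34 R p) : Prop :=
  forall U : {vspace 'rV[R]_p}, (forall x y, F x y \in U) -> U = fullv.

(** ** Normalization *)

(* [Fc F A B i j k l] is $F_{ij,kl} = \langle F(e_i,f_j), F(e_k,f_l)\rangle$,
   where $e_1,e_2,e_3$ are the rows of [A] and $f_1,\dots,f_4$ those of [B]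
   (orthonormal bases when [A] and [B] are orthogonal).  The indices [i j k l]
   are 1-based. *)
Definition Fc (R : realType) (p : nat) (F : mult34 R p)
    (A : 'M[R]_3) (B : 'M[R]_4) (i j k l : nat) : R :=
  let e m := row (inord m.-1) A in
  let f m := row (inord m.-1) B in
  dot (F (e i) (f j)) (F (e k) (f l)).

Definition normalized (R : realType) (p : nat) (F : mult34 R p)
    (A : 'M[R]_3) (B : 'M[R]_4) : Prop :=
  let F_ := Fc F A B in
  (F_ 3 1 1 2 = 0 /\ F_ 3 3 1 4 = 0) /\
  (F_ 3 1 2 2 = 0 /\ F_ 3 3 2 4 = 0) /\
  (F_ 3 1 2 3 = 0 /\ F_ 3 4 2 2 = 0) /\
  (F_ 1 1 2 3 + F_ 1 4 2 2 = 0) /\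
  (F_ 1 1 2 4 + F_ 1 2 2 3 = 0) /\
  (F_ 3 1 1 4 + F_ 3 2 1 3 = 0).

Definition beta (R : realType) (p : nat) (F : mult34 R p)
    (A : 'M[R]_3) (B : 'M[R]_4) : R := Fc F A B 3 1 1 4.

Definition degenerate (R : realType) (p : nat) (F : mult34 R p)
    (A : 'M[R]_3) (B : 'M[R]_4) : Prop :=
  beta F A B = 0 /\ Fc F A B 1 4 2 1 = 0 /\ Fc F A B 1 4 2 2 = 0.

(** ** Moduli spaces *)

(* Domain equivalence (by SO(3) x SO(4)) combined with range equivalence
   (by O(p)). *)
Definition om_equiv (R : realType) (p : nat) (F G : mult34 R p) : Prop :=
  exists (A : 'M[R]_3) (B : 'M[R]_4) (C : 'M[R]_p),
    [/\ isSO A, isSO B, isO C &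
        forall x y, G x y = F (x *m A) (y *m B) *m C].

Lemma isO_tr (R : realType) (n : nat) (A : 'M[R]_n) : isO A -> isO A^T.
Proof. by rewrite /isO trmxK => /mulmx1C. Qed.

Lemma isO_mul (R : realType) (n : nat) (A B : 'M[R]_n) :
  isO A -> isO B -> isO (A *m B).
Proof.
by rewrite /isO => hA hB; rewrite trmx_mul mulmxA -(mulmxA A) hB mulmx1.
Qed.

Lemma isO1 (R : realType) (n : nat) : isO (1%:M : 'M[R]_n).
Proof. by rewrite /isO trmx1 mulmx1. Qed.

Lemma om_equiv_refl (R : realType) (p : nat) (F : mult34 R p) : om_equiv F F.
Proof.
exists 1%:M, 1%:M, 1%:M; split; do ?exact: isO1.
- by split; [exact: isO1 | exact: det1].
- by split; [exact: isO1 | exact: det1].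
- by move=> x y; rewrite !mulmx1.
Qed.

Lemma om_equiv_sym (R : realType) (p : nat) (F G : mult34 R p) :
  om_equiv F G -> om_equiv G F.
Proof.
move=> [A [B [C [[oA dA] [oB dB] oC FG]]]].
exists A^T, B^T, C^T; split; do ?exact: isO_tr.
- by split; [exact: isO_tr | rewrite det_tr].
- by split; [exact: isO_tr | rewrite det_tr].
- by move=> x y; rewrite FG -!mulmxA (mulmx1C oA) (mulmx1C oB) oC !mulmx1.
Qed.

Lemma om_equiv_trans (R : realType) (p : nat) (F G H : mult34 R p) :
  om_equiv F G -> om_equiv G H -> om_equiv F H.
Proof.
move=> [A [B [C [[oA dA] [oB dB] oC FG]]]].
move=> [A' [B' [C' [[oA' dA'] [oB' dB'] oC' GH]]]].
exists (A' *m A), (B' *m B), (C *m C'); split; do ?exact: isO_mul.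
- by split; [exact: isO_mul | rewrite det_mulmx dA dA' mulr1].
- by split; [exact: isO_mul | rewrite det_mulmx dB dB' mulr1].
- by move=> x y; rewrite GH FG !mulmxA.
Qed.

(* Functions carry the topology of pointwise convergence; on bilinear maps this
   is the usual topology of the finite-dimensional space of their
   coefficients.  A set of functions used as a type has the subspace
   topology. *)
Section Moduli.
Import ArrowAsProduct.
Variables (R : realType) (p : nat) (S : set ('rV[R]_3 -> 'rV[R]_4 -> 'rV[R]_p)).

Definition om_equivb (F G : S) : bool := `[< om_equiv (\val F) (\val G) >].

Lemma om_equivb_refl : reflexive om_equivb.
Proof. by move=> F; apply/asboolP; exact: om_equiv_refl. Qed.

Lemma om_equivb_sym : symmetric om_equivb.
Proof.
by move=> F G; apply/idP/idP => /asboolP/om_equiv_sym h; apply/asboolP.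
Qed.

Lemma om_equivb_trans : transitive om_equivb.
Proof.
move=> G F H /asboolP FG /asboolP GH; apply/asboolP.
exact: om_equiv_trans FG GH.
Qed.

Definition om_equiv_rel : equiv_rel S :=
  EquivRel om_equivb om_equivb_refl om_equivb_sym om_equivb_trans.

(* The set [S] modulo equivalence, with the quotient topology. *)
Definition moduli_of : topologicalType :=
  quotient_topology {eq_quot om_equiv_rel}.

End Moduli.

Definition moduli (R : realType) (p : nat) : topologicalType :=
  moduli_of [set F : mult34 R p | orth_mult F].

Definition full_moduli (R : realType) (p : nat) : topologicalType :=
  moduli_of [set F : mult34 R p | orth_mult F /\ full F].

(** ** Lebesgue covering dimension *)

Definition open_covering (T : topologicalType) (U : set (set T)) : Prop :=
  U `<=` open /\ \bigcup_(A in U) A = setT.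

Definition refines (T : Type) (V U : set (set T)) : Prop :=
  forall A, V A -> exists2 B, U B & A `<=` B.

(* Every open covering has an open refinement such that each point lies in at
   most [n + 1] of its members. *)
Definition covdim_le (T : topologicalType) (n : nat) : Prop :=
  forall U : set (set T), open_covering U ->
  exists V : set (set T), [/\ open_covering V, refines V U &
    forall x : T, [set A | V A /\ A x] #<= `I_n.+1].

Definition covdim_eq (T : topologicalType) (n : nat) : Prop :=
  covdim_le T n /\ forall m, (m < n)%N -> ~ covdim_le T m.

(* Main.v *)
Require Import Defs.
From HB Require Import structures.
From mathcomp Require Import all_boot all_order all_algebra.
From mathcomp Require Import all_classical all_reals all_analysis.
From mathcomp Require Import ring lra.
Import Order.TTheory GRing.Theory Num.Theory.
Import numFieldNormedType.Exports.

(** Let M_i be the 4 x 7 matrix with rows F(e_i, f_a) ([slice]) and N_ij = M_i M_j^T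
    ([gram]).  That F is an orthogonal multiplication means that M_i M_i^T = 1 and
    that N_12, N_23, N_31 are skew, and these three matrices determine F up to an
    orthogonal transformation of the range ([gram_orthogonal]).  They depend
    linearly on a normal vector: for orthonormal x, y with cross product n, the products
    of F(x, .) and F(y, .) are given by a skew matrix N(n), which splits into
    commuting self-dual and anti-self-dual parts with coordinates p(n), q(n) in
    R^3.  The singular values of N(n) are |p(n)| + |q(n)| and ||p(n)| - |q(n)||.

    In R^7 the 4-spaces F(x, .) and F(y, .) meet, so N(n) has the singular value 1,
    the largest possible one: |p(n)| + |q(n)| = |n| for all n ([heron_identity],
    [bessel_le1]).  Removing the roots gives an identity of quadratic forms in
    which |n|^2 is irreducible, so |p|^2 and |q|^2 are multiples of |n|^2
    ([heron_forms]).  Thus p and q are l and m times orthogonal maps, with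
    l + m = 1 ([gram_structure]).  Following a common vector of two of the 4-spaces
    into the third determines the orientations of these maps ([orientation]), and a
    suitable rotation of R^4 brings the N_ij into a form that depends only on
    t = l - m ([normal_gram]).  Hence F is equivalent to [model t] ([normal_form]).

    In a normalized frame p is diagonal and q triangular; a triangular multiple of
    an orthogonal matrix is diagonal, which is the degenerate case
    ([normalized_degenerate]).

    The parameter t is the Pfaffian of N_12, a continuous invariant of the
    equivalence class ([invariant_equiv], [invariant_continuous]).  It identifies the
    moduli with [-1, 1], and those of the full maps with the open interval
    ([full_invariant], [model_full]).  Both are retracts of the line, so their
    covering dimension is at most that of the line ([covdim_le_line],
    [covdim_le_retract]), and they contain a nonconstant path ([covdim_gt0]). *)

Set Implicit Arguments.
Unset Strict Implicit.
Unset Printing Implicit Defensive.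

Local Open Scope ring_scope.

(** * Coordinates on R^3 and on skew 4 x 4 matrices *)

Notation o3 i := (@Ordinal 3 i isT).
Notation o4 i := (@Ordinal 4 i isT).

Section Coordinates.
Variable (R : realType).

Lemma sum3 (V : nmodType) (f : 'I_3 -> V) :
  \sum_(i < 3) f i = f (o3 0) + f (o3 1) + f (o3 2).
Proof.
rewrite !big_ord_recr big_ord0 /= add0r.
by congr (f _ + f _ + f _); apply: val_inj.
Qed.

Lemma sum4 (V : nmodType) (f : 'I_4 -> V) :
  \sum_(i < 4) f i = f (o4 0) + f (o4 1) + f (o4 2) + f (o4 3).
Proof.
rewrite !big_ord_recr big_ord0 /= add0r.
by congr (f _ + f _ + f _ + f _); apply: val_inj.
Qed.

Lemma ord3P (P : 'I_3 -> Prop) : P (o3 0) -> P (o3 1) -> P (o3 2) -> forall i, P i.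
Proof.
move=> P0 P1 P2 [[|[|[|//]]] i].
- by rewrite (_ : Ordinal _ = o3 0) //; apply: val_inj.
- by rewrite (_ : Ordinal _ = o3 1) //; apply: val_inj.
- by rewrite (_ : Ordinal _ = o3 2) //; apply: val_inj.
Qed.

Lemma ord4P (P : 'I_4 -> Prop) :
  P (o4 0) -> P (o4 1) -> P (o4 2) -> P (o4 3) -> forall i, P i.
Proof.
move=> P0 P1 P2 P3 [[|[|[|[|//]]]] i].
- by rewrite (_ : Ordinal _ = o4 0) //; apply: val_inj.
- by rewrite (_ : Ordinal _ = o4 1) //; apply: val_inj.
- by rewrite (_ : Ordinal _ = o4 2) //; apply: val_inj.
- by rewrite (_ : Ordinal _ = o4 3) //; apply: val_inj.
Qed.

Definition vec3 (a b c : R) : 'rV[R]_3 := \row_i nth 0 [:: a; b; c] i.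

Definition skew4 (a b c d e f : R) : 'M[R]_4 :=
  \matrix_(i, j) nth 0 (nth [::] [:: [:: 0; a; b; c]; [:: - a; 0; d; e];
    [:: - b; - d; 0; f]; [:: - c; - e; - f; 0]] i) j.

(** Left and right multiplications of the quaternions by [u], up to sign: [Lmx]
    and [Rmx] parametrize the self-dual and the anti-self-dual skew matrices. *)
Definition Lmx (u : 'rV[R]_3) : 'M[R]_4 :=
  skew4 (u 0 (o3 0)) (u 0 (o3 1)) (u 0 (o3 2)) (u 0 (o3 2)) (- u 0 (o3 1)) (u 0 (o3 0)).
Definition Rmx (u : 'rV[R]_3) : 'M[R]_4 :=
  skew4 (u 0 (o3 0)) (u 0 (o3 1)) (u 0 (o3 2)) (- u 0 (o3 2)) (u 0 (o3 1)) (- u 0 (o3 0)).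

Definition cross (u v : 'rV[R]_3) : 'rV[R]_3 :=
  vec3 (u 0 (o3 1) * v 0 (o3 2) - u 0 (o3 2) * v 0 (o3 1))
       (u 0 (o3 2) * v 0 (o3 0) - u 0 (o3 0) * v 0 (o3 2))
       (u 0 (o3 0) * v 0 (o3 1) - u 0 (o3 1) * v 0 (o3 0)).

Lemma cross_vec3 (a b c a' b' c' : R) : cross (vec3 a b c) (vec3 a' b' c') =
  vec3 (b * c' - c * b') (c * a' - a * c') (a * b' - b * a').
Proof. by rewrite /cross !mxE. Qed.

Lemma dot_vec3 (a b c a' b' c' : R) :
  dot (vec3 a b c) (vec3 a' b' c') = a * a' + b * b' + c * c'.
Proof. by rewrite /dot sum3 !mxE. Qed.

Lemma crossC u v : cross u v = - cross v u.
Proof. by apply/rowP; apply: ord3P; rewrite !mxE /=; ring. Qed.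

Lemma crossvv u : cross u u = 0 :> 'rV[R]_3.
Proof. by apply/rowP; apply: ord3P; rewrite !mxE /=; ring. Qed.

Lemma crossDl (u v w : 'rV[R]_3) : cross (u + v) w = cross u w + cross v w.
Proof. by apply/rowP; apply: ord3P; rewrite !mxE /=; ring. Qed.

Lemma crossZl a (u w : 'rV[R]_3) : cross (a *: u) w = a *: cross u w.
Proof. by apply/rowP; apply: ord3P; rewrite !mxE /=; ring. Qed.

Lemma crossDr (u v w : 'rV[R]_3) : cross w (u + v) = cross w u + cross w v.
Proof. by rewrite crossC crossDl opprD -!crossC. Qed.

Lemma crossZr a (u w : 'rV[R]_3) : cross w (a *: u) = a *: cross w u.
Proof. by rewrite crossC crossZl -scalerN -crossC. Qed.

Lemma dot_cross (u v : 'rV[R]_3) : dot u (cross u v) = 0.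
Proof. by rewrite /dot sum3 !mxE /=; ring. Qed.

Lemma lagrange (u v : 'rV[R]_3) :
  dot (cross u v) (cross u v) = dot u u * dot v v - dot u v ^+ 2.
Proof. by rewrite /dot !sum3 !mxE /=; ring. Qed.

Lemma LmxM u v : Lmx u *m Lmx v = (- dot u v)%:M - Lmx (cross u v).
Proof.
apply/matrixP; apply: ord4P; apply: ord4P;
rewrite !mxE sum4 /dot sum3 !mxE /= ?mulr0n ?mulr1n; ring.
Qed.

Lemma RmxM u v : Rmx u *m Rmx v = (- dot u v)%:M + Rmx (cross u v).
Proof.
apply/matrixP; apply: ord4P; apply: ord4P;
rewrite !mxE sum4 /dot sum3 !mxE /= ?mulr0n ?mulr1n; ring.
Qed.

Lemma LRmxC u v : Lmx u *m Rmx v = Rmx v *m Lmx u.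
Proof.
apply/matrixP; apply: ord4P; apply: ord4P;
rewrite !mxE !sum4 !mxE /=; ring.
Qed.

Lemma tr_Lmx_Rmx u v : \tr (Lmx u *m Rmx v) = 0.
Proof. rewrite /mxtrace sum4 !mxE !sum4 !mxE /=; ring. Qed.

(** The Pfaffian of a skew matrix. *)
Definition pf (N : 'M[R]_4) : R :=
  N (o4 0) (o4 1) * N (o4 2) (o4 3) - N (o4 0) (o4 2) * N (o4 1) (o4 3)
  + N (o4 0) (o4 3) * N (o4 1) (o4 2).

(** Entries are given by a function on [nat], so that the Laplace expansion
    computes on numerals instead of lifted ordinals. *)
Lemma det_matrix4 (G : nat -> nat -> R) :
  \det (\matrix_(i < 4, j < 4) G i j) =
  let d2 i j := G 2 i * G 3 j - G 2 j * G 3 i in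
  let d3 i j k := G 1 i * d2 j k - G 1 j * d2 i k + G 1 k * d2 i j in
  G 0 0 * d3 1 2 3 - G 0 1 * d3 0 2 3 + G 0 2 * d3 0 1 3 - G 0 3 * d3 0 1 2.
Proof.
rewrite (expand_det_row _ ord0) !big_ord_recl big_ord0 /cofactor.
rewrite !(expand_det_row _ ord0) !big_ord_recl !big_ord0 /cofactor.
rewrite !(expand_det_row _ ord0) !big_ord_recl !big_ord0 /cofactor !det_mx11 !mxE /=.
rewrite /bump /=; ring.
Qed.

Lemma skewE (N : 'M[R]_4) : N^T = - N -> forall i j, N j i = - N i j.
Proof. by move=> /matrixP h i j; move: (h i j); rewrite !mxE. Qed.

Lemma skew4E (N : 'M[R]_4) : N^T = - N ->
  N = skew4 (N (o4 0) (o4 1)) (N (o4 0) (o4 2)) (N (o4 0) (o4 3))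
          (N (o4 1) (o4 2)) (N (o4 1) (o4 3)) (N (o4 2) (o4 3)).
Proof.
move=> /skewE sk; have sk0 i : N i i = 0 by have := sk i i; lra.
by apply/matrixP; apply: ord4P; apply: ord4P; rewrite mxE /= ?sk0 // -?sk.
Qed.

(** Conjugation by an element of SO(4) keeps the Pfaffian, and hence tells the
    self-dual part of a skew matrix from the anti-self-dual one. *)
Lemma pf_conj (g N : 'M[R]_4) : N^T = - N ->
  pf (g *m N *m g^T) = \det g * pf N.
Proof.
move=> skN.
pose G i j := g (inord i) (inord j).
have gE : g = \matrix_(i < 4, j < 4) G i j.
  by apply/matrixP => i j; rewrite mxE /G !inord_val.
rewrite {}gE; move: G => G.
rewrite (skew4E skN).
rewrite det_matrix4 /pf !mxE !sum4 !mxE !sum4 !mxE /=.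
move: (N (o4 0) (o4 1)) (N (o4 0) (o4 2)) (N (o4 0) (o4 3))
      (N (o4 1) (o4 2)) (N (o4 1) (o4 3)) (N (o4 2) (o4 3)) => a b c d e f.
move: (G 0 0)%N (G 0 1)%N (G 0 2)%N (G 0 3)%N (G 1 0)%N (G 1 1)%N (G 1 2)%N (G 1 3)%N
 (G 2 0)%N (G 2 1)%N (G 2 2)%N (G 2 3)%N (G 3 0)%N (G 3 1)%N (G 3 2)%N (G 3 3)%N.
move=> g00 g01 g02 g03 g10 g11 g12 g13 g20 g21 g22 g23 g30 g31 g32 g33.
ring.
Qed.

End Coordinates.

(** * Inner products *)

Section Dot.
Variables (R : realType) (n : nat).
Implicit Types (u v w : 'rV[R]_n).

Lemma dotE u v : dot u v = (u *m v^T) 0 0.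
Proof. by rewrite mxE; apply: eq_bigr => i _; rewrite !mxE. Qed.

Lemma mul_tr_dot u v : u *m v^T = (dot u v)%:M.
Proof. by rewrite dotE -mx11_scalar. Qed.

Lemma dotC u v : dot u v = dot v u.
Proof. by apply: eq_bigr => i _; rewrite mulrC. Qed.

Lemma dotDl u v w : dot (u + v) w = dot u w + dot v w.
Proof. by rewrite !dotE mulmxDl mxE. Qed.

Lemma dotZl a u v : dot (a *: u) v = a * dot u v.
Proof. by rewrite !dotE -scalemxAl mxE. Qed.

Lemma dotNl u v : dot (- u) v = - dot u v.
Proof. by rewrite !dotE mulNmx mxE. Qed.

Lemma dotDr u v w : dot w (u + v) = dot w u + dot w v.
Proof. by rewrite dotC dotDl !(dotC w). Qed.

Lemma dotZr a u v : dot v (a *: u) = a * dot v u.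
Proof. by rewrite dotC dotZl !(dotC v). Qed.

Lemma dotNr u v : dot v (- u) = - dot v u.
Proof. by rewrite dotC dotNl !(dotC v). Qed.

Lemma dot0l u : dot 0 u = 0.
Proof. by rewrite dotE mul0mx mxE. Qed.

Lemma dot0r u : dot u 0 = 0.
Proof. by rewrite dotC dot0l. Qed.

Definition dot_lin := (dotDl, dotDr, dotZl, dotZr, dotNl, dotNr).

Lemma dot_ge0 u : 0 <= dot u u.
Proof. by apply: sumr_ge0 => i _; rewrite -expr2 sqr_ge0. Qed.

Lemma dot_eq0 u : dot u u = 0 -> u = 0.
Proof.
move=> /eqP; rewrite psumr_eq0; last by move=> i _; rewrite -expr2 sqr_ge0.
move=> /allP u0; apply/rowP => i; rewrite mxE.
by have := u0 i (mem_index_enum _); rewrite /= mulf_eq0 orbb => /eqP.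
Qed.

End Dot.

Section DotMatrix.
Variable R : realType.

Lemma dot_mulr n p (A : 'M[R]_(n, p)) u w : dot u (w *m A) = dot (u *m A^T) w.
Proof. by rewrite !dotE trmx_mul mulmxA. Qed.

Lemma isO_dot n (C : 'M[R]_n) u v : isO C -> dot (u *m C) (v *m C) = dot u v.
Proof. by move=> oC; rewrite dot_mulr -mulmxA oC mulmx1. Qed.

Lemma dot_delta n (i j : 'I_n) :
  dot (delta_mx 0 i : 'rV[R]_n) (delta_mx 0 j) = (i == j)%:R.
Proof. by rewrite dotE trmx_delta mul_delta_mx_cond; case: eqP; rewrite ?mulr1n ?mulr0n !mxE. Qed.

Lemma isO_rows n (A : 'M[R]_n) i j : isO A -> dot (row i A) (row j A) = (i == j)%:R.
Proof. by move=> oA; rewrite !rowE isO_dot // dot_delta. Qed.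

Lemma dot_row_mx m n (u u' : 'rV[R]_m) (v v' : 'rV[R]_n) :
  dot (row_mx u v) (row_mx u' v') = dot u u' + dot v v'.
Proof. by rewrite !dotE tr_row_mx mul_row_col mxE. Qed.

Lemma dot_scalar (a b : R) : dot (a%:M : 'rV_1) b%:M = a * b.
Proof. by rewrite /dot big_ord1 !mxE. Qed.

End DotMatrix.

Section Skew4.
Variable (R : realType).

(** The coordinates of the two summands of so(4) = so(3) + so(3). *)
Definition selfdual (N : 'M[R]_4) : 'rV[R]_3 :=
  vec3 ((N (o4 0) (o4 1) + N (o4 2) (o4 3)) / 2)
       ((N (o4 0) (o4 2) - N (o4 1) (o4 3)) / 2)
       ((N (o4 0) (o4 3) + N (o4 1) (o4 2)) / 2).
Definition antiselfdual (N : 'M[R]_4) : 'rV[R]_3 :=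
  vec3 ((N (o4 0) (o4 1) - N (o4 2) (o4 3)) / 2)
       ((N (o4 0) (o4 2) + N (o4 1) (o4 3)) / 2)
       ((N (o4 0) (o4 3) - N (o4 1) (o4 2)) / 2).

Lemma selfdual_decomposition (N : 'M[R]_4) : 
  N^T = - N -> N = Lmx (selfdual N) + Rmx (antiselfdual N).
Proof.
move=> sN; rewrite [LHS](skew4E sN).
by apply/matrixP; apply: ord4P; apply: ord4P; rewrite !mxE /=; field.
Qed.

Lemma selfdualD M N : selfdual (M + N) = selfdual M + selfdual N.
Proof. by apply/rowP; apply: ord3P; rewrite !mxE /=; field. Qed.
Lemma selfdualZ a N : selfdual (a *: N) = a *: selfdual N.
Proof. by apply/rowP; apply: ord3P; rewrite !mxE /=; field. Qed.
Lemma antiselfdualD M N : antiselfdual (M + N) = antiselfdual M + antiselfdual N.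
Proof. by apply/rowP; apply: ord3P; rewrite !mxE /=; field. Qed.
Lemma antiselfdualZ a N : antiselfdual (a *: N) = a *: antiselfdual N.
Proof. by apply/rowP; apply: ord3P; rewrite !mxE /=; field. Qed.

Lemma pf_selfdual (N : 'M[R]_4) :
  pf N = dot (selfdual N) (selfdual N) - dot (antiselfdual N) (antiselfdual N).
Proof. by rewrite /pf /dot !sum3 !mxE /=; field. Qed.

Lemma LmxZ a u : Lmx (a *: u) = a *: Lmx u :> 'M[R]_4.
Proof. by apply/matrixP; apply: ord4P; apply: ord4P; rewrite !mxE /=; ring. Qed.
Lemma RmxZ a u : Rmx (a *: u) = a *: Rmx u :> 'M[R]_4.
Proof. by apply/matrixP; apply: ord4P; apply: ord4P; rewrite !mxE /=; ring. Qed.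
Lemma Lmx0 : Lmx 0 = 0 :> 'M[R]_4.
Proof. by rewrite -(scale0r (0 : 'rV[R]_3)) LmxZ !scale0r. Qed.
Lemma Rmx0 : Rmx 0 = 0 :> 'M[R]_4.
Proof. by rewrite -(scale0r (0 : 'rV[R]_3)) RmxZ !scale0r. Qed.

Lemma LmxMv (u : 'rV[R]_3) : Lmx u *m Lmx u = (- dot u u)%:M.
Proof. by rewrite LmxM crossvv Lmx0 subr0. Qed.
Lemma RmxMv (u : 'rV[R]_3) : Rmx u *m Rmx u = (- dot u u)%:M.
Proof. by rewrite RmxM crossvv Rmx0 addr0. Qed.

(** Eight rows in R^7 are linearly dependent. *)
Lemma row_spaces_meet (X Y : 'M[R]_(4, 7)) :
  exists u v : 'rV[R]_4, u *m X = v *m Y /\ (u != 0) || (v != 0).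
Proof.
pose Z := col_mx X (- Y).
have : kermx Z != 0.
  rewrite kermx_eq0 /row_free; apply/eqP => h.
  by have := rank_leq_col Z; rewrite h.
case/rowV0Pn => w /sub_kermxP wZ w0.
exists (lsubmx w), (rsubmx w); split.
  apply/eqP; rewrite -subr_eq0 -mulmxN -mul_row_col hsubmxK; exact/eqP.
apply: contraNT w0; rewrite negb_or !negbK => /andP[/eqP a /eqP b].
by rewrite -(hsubmxK w) a b row_mx0.
Qed.

(** The identity says that |p| + |q| = sqrt c or ||p| - |q|| = sqrt c, where p
    and q are the two parts of [N]: a common vector of the two row spaces is an
    eigenvector of [N ^+ 2] with eigenvalue [- c], while the commuting parts of
    [N] square to the scalars - |p|^2 and - |q|^2. *)
Lemma heron_identity (X Y : 'M[R]_(4, 7)) (c : R) (N := X *m Y^T) :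
  X *m X^T = 1%:M -> Y *m Y^T = c%:M -> N^T = - N ->
  (c - dot (selfdual N) (selfdual N) - dot (antiselfdual N) (antiselfdual N)) ^+ 2 =
  4 * dot (selfdual N) (selfdual N) * dot (antiselfdual N) (antiselfdual N).
Proof.
move=> XX YY skN.
have [u [v [uv uv0]]] := row_spaces_meet X Y.
have uE : u = - (v *m N).
  by rewrite -mulmxN -skN /N trmx_mul trmxK mulmxA -uv -mulmxA XX mulmx1.
have v0 : v != 0.
  by apply: contraTneq uv0 => v0; rewrite uE v0 mul0mx oppr0 eqxx.
have vE : v *m (N *m N) = - (c *: v).
  rewrite mulmxA -[v *m N]opprK -uE mulNmx /N mulmxA uv -mulmxA YY.
  by rewrite mul_mx_scalar.
have := selfdual_decomposition skN; move: vE; move: N {skN uE} => N + NE.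
set p := selfdual N in NE *; set q := antiselfdual N in NE *.
set a := dot p p; set b := dot q q.
set S := Lmx p in NE; set A := Rmx q in NE; rewrite {}NE => vE.
have SS : S *m S = (- a)%:M by exact: LmxMv.
have AA : A *m A = (- b)%:M by exact: RmxMv.
have SA : S *m A = A *m S by exact: LRmxC.
have vSA : (c - a - b) *: v = - (v *m (S *m A) *+ 2).
  move: vE; rewrite mulmxDl !mulmxDr SS AA -SA !mul_mx_scalar.
  move=> /rowP h; apply/rowP => i; move: (h i); rewrite !mxE ?mulr2n ?mxE.
  by set t := \sum_j _ => {}h; lra.
have sq : S *m A *m (S *m A) = (a * b)%:M.
  rewrite mulmxA {1}SA -(mulmxA A) SS mul_mx_scalar -scalemxAl AA.
  by rewrite scale_scalar_mx mulrNN.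
have : (c - a - b) *: ((c - a - b) *: v) = (4 * a * b) *: v.
  have -> : (c - a - b) *: ((c - a - b) *: v) =
            - (((c - a - b) *: v) *m (S *m A) *+ 2).
    by rewrite [X in _ *: X = _]vSA scalerN -scalerMnr scalemxAl.
  rewrite vSA mulNmx -[_ *+ 2 in X in X *m _]scaler_nat -scalemxAl -mulmxA sq.
  rewrite mul_mx_scalar mulNrn opprK -scaler_nat !scalerA; congr (_ *: _); ring.
rewrite scalerA -expr2 => /eqP; rewrite -subr_eq0 -scalerBl scaler_eq0 (negPf v0).
by rewrite orbF subr_eq0 => /eqP.
Qed.

End Skew4.

(** * Quadratic forms of the normal direction *)

Section Structure.
Variable (R : realType).

(** With a, b, c = x^2 + y^2 the three forms and q = c + b - a, the hypothesis
    reads q^2 = 4 b c.  As c is irreducible over the reals, it divides q, which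
    makes q, then b, and then a multiples of c.  The proof replaces divisibility
    by a comparison of the coefficients of q^2 and 4 b c. *)
Lemma heron_forms (a1 a2 a3 b1 b2 b3 : R) :
  (forall x y, let a := a1 * x ^+ 2 + 2 * a2 * x * y + a3 * y ^+ 2 in
     let b := b1 * x ^+ 2 + 2 * b2 * x * y + b3 * y ^+ 2 in
     (x ^+ 2 + y ^+ 2 - a - b) ^+ 2 = 4 * a * b) ->
  [/\ a2 = 0, b2 = 0, a1 = a3 & b1 = b3].
Proof.
move=> H.
have h10 := H 1 0; have h01 := H 0 1; have h11 := H 1 1.
have h1n := H 1 (-1); have h12 := H 1 2.
have h1m := H 1 (-2).
pose al := 1 + b1 - a1; pose be := b2 - a2; pose ga := 1 + b3 - a3.
have e4 : al ^+ 2 = 4 * b1 by rewrite /al; move: h10 => /=; lra.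
have e0 : ga ^+ 2 = 4 * b3 by rewrite /ga; move: h01 => /=; lra.
have e3 : al * be = 2 * b2.
  by rewrite /al /be; move: h10 h01 h11 h1n h12 h1m => /=; lra.
have e1 : be * ga = 2 * b2.
  by rewrite /ga /be; move: h10 h01 h11 h1n h12 h1m => /=; lra.
have e2 : 4 * be ^+ 2 + 2 * al * ga = 4 * (b1 + b3).
  by rewrite /al /ga /be; move: h10 h01 h11 h1n h12 h1m => /=; lra.
have d2 : 4 * be ^+ 2 = (al - ga) ^+ 2 by lra.
have d1 : be * (al - ga) = 0 by lra.
have be0 : be = 0.
  have : be ^+ 2 * be ^+ 2 = 0.
    have -> : be ^+ 2 * be ^+ 2 = (be * (al - ga)) ^+ 2 / 4.
      by rewrite exprMn -d2; field.
    by rewrite d1 expr0n mul0r.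
  by move=> /eqP; rewrite mulf_eq0 !sqrf_eq0 orbb => /eqP.
have ag : al = ga.
  by move/eqP: d2; rewrite be0 expr0n mulr0 eq_sym sqrf_eq0 subr_eq0 => /eqP.
have b20 : b2 = 0 by move: e3; rewrite be0; lra.
have b13 : b1 = b3 by move: e4 e0; rewrite ag; lra.
move: ag be0; rewrite /al /ga /be => ag be0; split; lra.
Qed.

(** [heron_identity] holds for [X] and every combination of [Y] and [Z], so
    [heron_forms] applies to the squared lengths of both parts of [x N + y N']. *)
Lemma pencil_orthogonal (X Y Z : 'M[R]_(4, 7)) (N := X *m Y^T) (N' := X *m Z^T) :
  X *m X^T = 1%:M -> Y *m Y^T = 1%:M -> Z *m Z^T = 1%:M ->
  N^T = - N -> N'^T = - N' -> (Y *m Z^T)^T = - (Y *m Z^T) ->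
  [/\ dot (selfdual N) (selfdual N') = 0, dot (antiselfdual N) (antiselfdual N') = 0,
      dot (selfdual N) (selfdual N) = dot (selfdual N') (selfdual N') &
      dot (antiselfdual N) (antiselfdual N) = dot (antiselfdual N') (antiselfdual N')].
Proof.
move=> XX YY ZZ sN sN' sYZ.
apply: heron_forms => x y a b.
pose W := x *: Y + y *: Z.
have WW : W *m W^T = (x ^+ 2 + y ^+ 2)%:M.
  rewrite /W linearD /= !linearZ /= mulmxDl !mulmxDr -!scalemxAl -!scalemxAr YY ZZ.
  have -> : Z *m Y^T = - (Y *m Z^T) by rewrite -sYZ trmx_mul trmxK.
  rewrite !scalerN [x *: (y *: _)]scalerA [y *: (x *: _)]scalerA (mulrC y x).
  rewrite addrA addrK !scalerA !scale_scalar_mx !mulr1 -!expr2.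
  by rewrite -raddfD.
have NE : X *m W^T = x *: N + y *: N'.
  by rewrite /W linearD /= !linearZ /= mulmxDr -!scalemxAr.
have sW : (X *m W^T)^T = - (X *m W^T).
  by rewrite NE linearD /= !linearZ /= sN sN' !scalerN opprD.
have := heron_identity XX WW sW.
have -> : dot (selfdual (X *m W^T)) (selfdual (X *m W^T)) = a.
  by rewrite NE selfdualD !selfdualZ !dot_lin (dotC (selfdual N')) /a; ring.
have -> // : dot (antiselfdual (X *m W^T)) (antiselfdual (X *m W^T)) = b.
by rewrite NE antiselfdualD !antiselfdualZ !dot_lin (dotC (antiselfdual N')) /b; ring.
Qed.

(** The rows of [X] have orthogonal projections of length at most 1 on the row
    space of [Y]; this excludes the solution ||p| - |q|| = 1 of
    [heron_identity]. *)
Lemma bessel_le1 (X Y : 'M[R]_(4, 7)) (N := X *m Y^T) :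
  X *m X^T = 1%:M -> Y *m Y^T = 1%:M -> N^T = - N ->
  dot (selfdual N) (selfdual N) + dot (antiselfdual N) (antiselfdual N) <= 1.
Proof.
move=> XX YY sN.
have E : (X - N *m Y) *m (X - N *m Y)^T = 1%:M + N *m N.
  rewrite linearB /= mulmxBr !mulmxBl XX trmx_mul sN !mulmxN.
  rewrite [X *m (Y^T *m _)]mulmxA -/N -(mulmxA N Y X^T).
  have -> : Y *m X^T = - N by rewrite -sN /N trmx_mul trmxK.
  rewrite -!mulmxA [Y *m _]mulmxA YY mul1mx !mulmxN !opprK.
  by rewrite addNr subr0.
have : 0 <= \tr (1%:M + N *m N).
  rewrite -E /mxtrace; apply: sumr_ge0 => i _; rewrite mxE.
  by apply: sumr_ge0 => j _; rewrite !mxE -expr2 sqr_ge0.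
rewrite {E}; have := selfdual_decomposition sN; move: N {sN} => N.
move: (selfdual N) (antiselfdual N) => p q ->.
rewrite mulmxDl !mulmxDr LmxMv RmxMv !mxtraceD -(LRmxC p q) tr_Lmx_Rmx !mxtrace_scalar.
lra.
Qed.

End Structure.

(** * Orthonormal triples and their common vectors *)

Section Frame.
Variable (R : realType).
Implicit Types (u v w : 'rV[R]_3).

Definition scaled_triple (c : R) u1 u2 u3 :=
  [/\ dot u1 u1 = c, dot u2 u2 = c & dot u3 u3 = c] /\
  [/\ dot u1 u2 = 0, dot u2 u3 = 0 & dot u3 u1 = 0].

(** The sign is the determinant of the triple: its square is a Gram determinant. *)
Lemma cross_triple j1 j2 j3 : scaled_triple 1 j1 j2 j3 ->
  exists2 e : R, e ^+ 2 = 1 & cross j2 j3 = e *: j1.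
Proof.
move=> [[n1 n2 n3] [n12 n23 n31]].
pose d := dot (cross j2 j3) j1.
have gram : d ^+ 2 = dot j1 j1 * dot j2 j2 * dot j3 j3 +
    2 * dot j1 j2 * dot j2 j3 * dot j3 j1 - dot j1 j1 * dot j2 j3 ^+ 2
    - dot j2 j2 * dot j3 j1 ^+ 2 - dot j3 j3 * dot j1 j2 ^+ 2.
  by rewrite /d /dot !sum3 !mxE /=; ring.
have d2 : d ^+ 2 = 1 by rewrite gram n1 n2 n3 n12 n23 n31; ring.
exists d => //; apply/eqP; rewrite -subr_eq0; apply/eqP/dot_eq0.
rewrite !dot_lin lagrange (dotC j1) -/d n1 n2 n3 n23; move: d2; lra.
Qed.

(** When [c = 0] the vectors vanish and the orthonormal triple is free, so that
    its orientation [e0] can be prescribed. *)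
Lemma unscale_triple (c e0 : R) u1 u2 u3 : 0 <= c -> e0 ^+ 2 = 1 ->
  scaled_triple (c ^+ 2) u1 u2 u3 ->
  exists j1 j2 j3 (e : R),
    [/\ scaled_triple 1 j1 j2 j3,
        [/\ u1 = c *: j1, u2 = c *: j2 & u3 = c *: j3],
        cross j2 j3 = e *: j1, e ^+ 2 = 1 & (c = 0 -> e = e0)].
Proof.
move=> c0 e01 [[n1 n2 n3] [n12 n23 n31]].
have [c1|c1] := eqVneq c 0.
  move: n1 n2 n3; rewrite c1 expr0n /= => n1 n2 n3.
  exists (vec3 e0 0 0), (vec3 0 1 0), (vec3 0 0 1), e0; split => //.
  - by rewrite /scaled_triple /dot !sum3 !mxE /=; split; split; lra.
  - by rewrite !scale0r (dot_eq0 n1) (dot_eq0 n2) (dot_eq0 n3).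
  - by apply/rowP; apply: ord3P; rewrite !mxE /=; lra.
have sc : scaled_triple 1 (c^-1 *: u1) (c^-1 *: u2) (c^-1 *: u3).
  rewrite /scaled_triple !dot_lin n1 n2 n3 n12 n23 n31 !mulr0.
  by split; split => //; field.
have [e e2 ce] := cross_triple sc.
exists (c^-1 *: u1), (c^-1 *: u2), (c^-1 *: u3), e; split => //.
- by rewrite !scalerA divff // !scale1r.
- by move=> c2; rewrite c2 eqxx in c1.
Qed.

Lemma LmxN u : Lmx (- u) = - Lmx u.
Proof. by rewrite -scaleN1r LmxZ scaleN1r. Qed.
Lemma RmxN u : Rmx (- u) = - Rmx u.
Proof. by rewrite -scaleN1r RmxZ scaleN1r. Qed.

Lemma Lmx_orthoM u v : dot u v = 0 -> Lmx u *m Lmx v = - Lmx (cross u v).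
Proof. by move=> uv; rewrite LmxM uv oppr0 raddf0 add0r. Qed.
Lemma Rmx_orthoM u v : dot u v = 0 -> Rmx u *m Rmx v = Rmx (cross u v).
Proof. by move=> uv; rewrite RmxM uv oppr0 raddf0 add0r. Qed.

Lemma Lmx_anti u v : dot u v = 0 -> Lmx u *m Lmx v = - (Lmx v *m Lmx u).
Proof.
by move=> uv; rewrite !Lmx_orthoM // 1?dotC // (crossC v) LmxN opprK.
Qed.
Lemma Rmx_anti u v : dot u v = 0 -> Rmx u *m Rmx v = - (Rmx v *m Rmx u).
Proof.
by move=> uv; rewrite !Rmx_orthoM // 1?dotC // (crossC v) RmxN opprK.
Qed.

Lemma Lmx_tr u : (Lmx u)^T = - Lmx u.
Proof. by apply/matrixP; apply: ord4P; apply: ord4P; rewrite !mxE /=; ring. Qed.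

(** [Lmx j1 *m Rmx k1] and [Lmx j3 *m Rmx k3] are commuting involutions, and
    their product is again of the form [Lmx *m Rmx]; such products are traceless.
    The projection onto the common eigenspace for the eigenvalue -1 therefore
    has trace 1 (the matrix [P] below is four times it), and is not zero. *)
Lemma common_vector j1 j3 k1 k3 :
  dot j1 j1 = 1 -> dot j3 j3 = 1 -> dot j1 j3 = 0 ->
  dot k1 k1 = 1 -> dot k3 k3 = 1 -> dot k1 k3 = 0 ->
  exists v : 'rV[R]_4, [/\ v *m Rmx k1 = v *m Lmx j1,
    v *m Rmx k3 = v *m Lmx j3 & dot v v = 1].
Proof.
move=> j11 j33 j13 k11 k33 k13.
pose T1 := Lmx j1 *m Rmx k1; pose T3 := Lmx j3 *m Rmx k3.
have sq j k : dot j j = 1 -> dot k k = 1 ->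
    (Lmx j *m Rmx k) *m (Lmx j *m Rmx k) = 1%:M.
  move=> jj kk; rewrite mulmxA -(mulmxA (Lmx j)) -LRmxC mulmxA -mulmxA.
  by rewrite LmxMv RmxMv jj kk -scalar_mxM mulrNN mulr1.
have T13 : T1 *m T3 = T3 *m T1.
  rewrite /T1 /T3 -[LHS]mulmxA [Rmx k1 *m _]mulmxA -LRmxC -[RHS]mulmxA.
  rewrite [Rmx k3 *m (_ *m _)]mulmxA -LRmxC -!mulmxA [LHS]mulmxA [RHS]mulmxA.
  by rewrite (Lmx_anti j13) (Rmx_anti k13) mulNmx mulmxN opprK.
pose P := (1%:M - T1) *m (1%:M - T3).
have refl T : T *m T = 1%:M -> (1%:M - T) *m T = - (1%:M - T).
  by move=> TT; rewrite mulmxBl mul1mx TT opprB.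
have P1 : P *m T1 = - P.
  have c : (1%:M - T3) *m T1 = T1 *m (1%:M - T3).
    by rewrite mulmxBl mulmxBr mul1mx mulmx1 T13.
  by rewrite /P -mulmxA c mulmxA refl ?mulNmx // sq.
have P3 : P *m T3 = - P by rewrite /P -mulmxA refl ?mulmxN // sq.
have trP : \tr P = 4.
  have tr13 : \tr (T1 *m T3) = 0.
    have -> : T1 *m T3 = (Lmx j1 *m Lmx j3) *m (Rmx k1 *m Rmx k3).
      by rewrite /T1 /T3 -!mulmxA; congr (_ *m _); rewrite !mulmxA LRmxC.
    by rewrite (Lmx_orthoM j13) (Rmx_orthoM k13) mulNmx raddfN /= tr_Lmx_Rmx oppr0.
  rewrite /P mulmxBl mul1mx mulmxBr mulmx1 !raddfB /= mxtrace1 tr13.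
  by rewrite /T1 /T3 !tr_Lmx_Rmx; lra.
have [v [i vE] v0] : exists2 v, (exists i, v = row i P) & v != 0.
  have /rowV0Pn[w /submxP[D ->] wP] : P != 0.
    by apply/eqP => P0; move: trP; rewrite P0 mxtrace0; lra.
  have [/existsP[i Pi]|/existsPn h] := boolP [exists i, row i P != 0].
    by exists (row i P) => //; exists i.
  case/eqP: wP; rewrite (_ : P = 0) ?mulmx0 //; apply/row_matrixP => i.
  by rewrite row0; apply/eqP; have := h i; rewrite negbK.
have eig j k : dot j j = 1 -> v *m (Lmx j *m Rmx k) = - v -> v *m Rmx k = v *m Lmx j.
  move=> jj h; have := congr1 (fun x => x *m Lmx j) h => /=.
  rewrite -mulmxA -(mulmxA (Lmx j)) -LRmxC mulmxA -mulmxA (mulmxA (Lmx j)) LmxMv jj.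
  rewrite mul_scalar_mx -scalemxAr mulNmx scaleN1r => /oppr_inj.
  by [].
have vv : 0 < dot v v.
  rewrite lt_def dot_ge0 andbT; apply: contraNneq v0 => /dot_eq0 ->; exact: eqxx.
exists ((Num.sqrt (dot v v))^-1 *: v); split.
- by rewrite -!scalemxAl (eig j1) // vE -row_mul P1 linearN.
- by rewrite -!scalemxAl (eig j3) // vE -row_mul P3 linearN.
- rewrite !dot_lin mulrA -expr2 exprVn sqr_sqrtr ?ltW // mulVf //.
  by rewrite gt_eqF.
Qed.

End Frame.

(** * Quaternionic frames *)

Section FrameForm.
Variable (R : realType).

(** In the frame made of [f] and of its images under the [J] (up to sign), both
    triples become the standard signed permutations.  Its determinant is 1
    because the Pfaffian of [J3] is 1 in both frames. *)
Lemma quaternion_frame (j1 j2 j3 k1 k2 k3 : 'rV[R]_3) (f : 'rV[R]_4)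
    (J1 := Lmx j1) (J2 := Lmx j2) (J3 := Lmx j3)
    (K1 := Rmx k1) (K2 := Rmx k2) (K3 := Rmx k3) :
  scaled_triple 1 j1 j2 j3 -> J3 *m J2 = J1 -> dot f f = 1 ->
  f *m K1 = - (f *m J1) -> f *m K2 = - (f *m J2) -> f *m K3 = - (f *m J3) ->
  exists2 g : 'M[R]_4, isSO g &
  [/\ [/\ g *m J1 = skew4 0 0 (-1) (-1) 0 0 *m g,
          g *m J2 = skew4 0 (-1) 0 0 1 0 *m g &
          g *m J3 = skew4 (-1) 0 0 0 0 (-1) *m g] &
      [/\ g *m K1 = skew4 0 0 1 (-1) 0 0 *m g,
          g *m K2 = skew4 0 1 0 0 1 0 *m g &
          g *m K3 = skew4 1 0 0 0 0 (-1) *m g]].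
Proof.
move=> [[n1 n2 n3] [n12 n23 n31]] J32 ff fK1 fK2 fK3.
have sq1 : J1 *m J1 = - 1%:M by rewrite LmxMv n1 raddfN.
have sq2 : J2 *m J2 = - 1%:M by rewrite LmxMv n2 raddfN.
have sq3 : J3 *m J3 = - 1%:M by rewrite LmxMv n3 raddfN.
have J23 : J2 *m J3 = - J1 by rewrite Lmx_anti // -/J2 -/J3 J32.
have J13 : J1 *m J3 = J2.
  have a : J1 *m J3 = - (J3 *m J1) by rewrite Lmx_anti // dotC.
  by rewrite a -J32 mulmxA sq3 mulNmx mul1mx opprK.
have J31 : J3 *m J1 = - J2 by rewrite Lmx_anti // -/J1 -/J3 J13.
have J12 : J1 *m J2 = - J3 by rewrite -J32 -mulmxA sq2 mulmxN mulmx1.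
have J21 : J2 *m J1 = J3 by rewrite Lmx_anti 1?dotC // -/J1 -/J2 J12 opprK.
have fJJ := (sq1, sq2, sq3, J12, J21, J13, J31, J23, J32).
have fJK a b c : f *m Rmx b = - (f *m Lmx c) ->
    f *m Lmx a *m Rmx b = - (f *m (Lmx c *m Lmx a)).
  by move=> fb; rewrite -mulmxA LRmxC mulmxA fb mulNmx mulmxA.
have fJKs := (fJK j1 _ _ fK1, fJK j2 _ _ fK1, fJK j3 _ _ fK1,
  fJK j1 _ _ fK2, fJK j2 _ _ fK2, fJK j3 _ _ fK2,
  fJK j1 _ _ fK3, fJK j2 _ _ fK3, fJK j3 _ _ fK3, fK1, fK2, fK3).
pose h (a : 'I_4) := nth 0 [:: f; - (f *m J3); - (f *m J2); - (f *m J1)] a.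
pose g := \matrix_(a < 4) h a.
have rows (A T : 'M[R]_4) : (forall a, h a *m A =
    T a (o4 0) *: f - T a (o4 1) *: (f *m J3) - T a (o4 2) *: (f *m J2)
     - T a (o4 3) *: (f *m J1)) -> g *m A = T *m g.
  move=> hA; apply/row_matrixP => a; rewrite !row_mul [RHS]mulmx_sum_row sum4 !rowK hA.
  by rewrite !mxE /h /= !scalerN.
have simp := (@mulmxN, @mulmx1, @oppr0, @scale0r, @scaleN1r, @opprK, @scale1r,
  @addr0, @subr0, @sub0r, @add0r).
have gJ1 : g *m J1 = skew4 0 0 (-1) (-1) 0 0 *m g.
  apply: rows; apply: ord4P; rewrite !mxE /h /= ?mulNmx -?(mulmxA f) ?fJJ;
  by rewrite ?simp.
have gJ2 : g *m J2 = skew4 0 (-1) 0 0 1 0 *m g.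
  apply: rows; apply: ord4P; rewrite !mxE /h /= ?mulNmx -?(mulmxA f) ?fJJ;
  by rewrite ?simp.
have gJ3 : g *m J3 = skew4 (-1) 0 0 0 0 (-1) *m g.
  apply: rows; apply: ord4P; rewrite !mxE /h /= ?mulNmx -?(mulmxA f) ?fJJ;
  by rewrite ?simp.
have gK1 : g *m K1 = skew4 0 0 1 (-1) 0 0 *m g.
  apply: rows; apply: ord4P; rewrite !mxE /h /= ?mulNmx ?fJKs ?fJJ;
  by rewrite ?simp.
have gK2 : g *m K2 = skew4 0 1 0 0 1 0 *m g.
  apply: rows; apply: ord4P; rewrite !mxE /h /= ?mulNmx ?fJKs ?fJJ;
  by rewrite ?simp.
have gK3 : g *m K3 = skew4 1 0 0 0 0 (-1) *m g.
  apply: rows; apply: ord4P; rewrite !mxE /h /= ?mulNmx ?fJKs ?fJJ;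
  by rewrite ?simp.
have fskew (A : 'M[R]_4) : A^T = - A -> f *m A *m f^T = 0.
  move=> sA; have : (f *m A *m f^T)^T = - (f *m A *m f^T).
    by rewrite !trmx_mul trmxK sA mulNmx mulmxN mulmxA.
  move=> /matrixP/(_ 0 0); rewrite !mxE => e.
  apply/matrixP => i k; rewrite !ord1 mxE [RHS]mxE; lra.
have fLf : (f *m J1 *m f^T = 0) * (f *m J2 *m f^T = 0) * (f *m J3 *m f^T = 0).
  by split; [split|]; apply: fskew; exact: Lmx_tr.
have ffT : f *m f^T = 1%:M by rewrite mul_tr_dot ff.
have gg : isO g. {
  apply/matrixP => a b.
  have -> : (g *m g^T) a b = (h a *m (h b)^T) 0 0.
    by rewrite !mxE; apply: eq_bigr => k _; rewrite !mxE.
  move: a b; apply: ord4P; apply: ord4P; rewrite /h /= ?linearN /= ?trmx_mul ?Lmx_tr.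
  all: rewrite -?/J1 -?/J2 -?/J3 ?(mulNmx, mulmxN) ?mulmxA -?(mulmxA f) ?fJJ.
  all: rewrite ?(mulNmx, mulmxN, mulmx1, opprK) ?mulmxA ?fLf ?ffT ?oppr0.
  all: by rewrite ?mulmx1 ?ffT !mxE. }
exists g; last by [].
split => //.
have := pf_conj g (Lmx_tr j3); rewrite -/J3 gJ3 -mulmxA (gg : g *m g^T = _) mulmx1.
have -> : pf (skew4 (-1) 0 0 0 0 (-1) : 'M[R]_4) = 1 by rewrite /pf !mxE /=; ring.
rewrite pf_selfdual.
have -> : selfdual J3 = j3 by apply/rowP; apply: ord3P; rewrite !mxE /=; field.
have -> : antiselfdual J3 = 0 by apply/rowP; apply: ord3P; rewrite !mxE /=; field.
by rewrite n3 dotE mul0mx mxE subr0 mulr1.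
Qed.

(** The two parts of the Gram matrices are multiples [l] and [m] of orthonormal
    triples, and [l + m = 1] expresses that two of the three 4-spaces meet. *)
Lemma gram_structure (M1 M2 M3 : 'M[R]_(4, 7)) (N3 := M1 *m M2^T)
    (N1 := M2 *m M3^T) (N2 := M3 *m M1^T) :
  M1 *m M1^T = 1%:M -> M2 *m M2^T = 1%:M -> M3 *m M3^T = 1%:M ->
  N1^T = - N1 -> N2^T = - N2 -> N3^T = - N3 ->
  exists l m : R, [/\ 0 <= l, 0 <= m, l + m = 1,
    scaled_triple (l ^+ 2) (selfdual N1) (selfdual N2) (selfdual N3) &
    scaled_triple (m ^+ 2) (antiselfdual N1) (antiselfdual N2) (antiselfdual N3)].
Proof.
move=> MM1 MM2 MM3 sN1 sN2 sN3.
have tr13 : M1 *m M3^T = - N2 by rewrite -sN2 /N2 trmx_mul trmxK.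
have tr21 : M2 *m M1^T = - N3 by rewrite -sN3 /N3 trmx_mul trmxK.
have tr32 : M3 *m M2^T = - N1 by rewrite -sN1 /N1 trmx_mul trmxK.
have [] := pencil_orthogonal MM1 MM2 MM3 sN3 _ sN1; first by rewrite tr13 linearN /= sN2.
rewrite tr13 -/N3 -scaleN1r selfdualZ antiselfdualZ !dot_lin => /eqP + /eqP +.
rewrite !mulN1r !opprK !oppr_eq0 => /eqP s32 /eqP a32 s3 a3.
have [] := pencil_orthogonal MM2 MM3 MM1 sN1 _ sN2; first by rewrite tr21 linearN /= sN3.
rewrite tr21 -/N1 -scaleN1r selfdualZ antiselfdualZ !dot_lin => /eqP + /eqP +.
rewrite !mulN1r !opprK !oppr_eq0 => /eqP s13 /eqP a13 s1 a1.
have [] := pencil_orthogonal MM3 MM1 MM2 sN2 _ sN3; first by rewrite tr32 linearN /= sN1.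
rewrite tr32 -/N2 -scaleN1r selfdualZ antiselfdualZ !dot_lin => /eqP + /eqP +.
rewrite !mulN1r !opprK !oppr_eq0 => /eqP s21 /eqP a21 s2 a2.
have := heron_identity MM1 MM2 sN3; have := bessel_le1 MM1 MM2 sN3; rewrite -/N3.
set a := dot (selfdual N3) _; set b := dot (antiselfdual N3) _ => ab1 abE.
have a0 : 0 <= a := dot_ge0 _.
have b0 : 0 <= b := dot_ge0 _.
have la := sqrtr_ge0 a; have lb := sqrtr_ge0 b.
have ea := sqr_sqrtr a0; have eb := sqr_sqrtr b0.
move: (Num.sqrt a) (Num.sqrt b) la lb ea eb => l m l0 m0 la mb.
exists l, m; split => //.
- have e : 1 - a - b = 2 * l * m.
    apply/eqP; rewrite -(eqrXn2 (ltn0Sn 1)) //; last 2 first.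
    + by move: ab1; lra.
    + by rewrite !mulr_ge0.
    by rewrite abE -la -mb; apply/eqP; ring.
  apply/eqP; rewrite -(eqrXn2 (ltn0Sn 1)) ?addr_ge0 // expr1n.
  by apply/eqP; move: e; rewrite -la -mb; lra.
- by rewrite la; split; split; rewrite ?s1 -?s3 // dotC.
- by rewrite mb; split; split; rewrite ?a1 -?a3 // dotC.
Qed.

End FrameForm.

(** * Orientation and the normal form of the Gram matrices *)

Section NormalGram.
Variable (R : realType).

(** The vector [v] is chosen so that [v *m M2] also lies in the row space of
    [M1], as [- (v *m Lmx j3) *m M1].  Pairing both expressions with [M3] relates
    the product [N3 *m N2] to [N1], which ties the signs [s] and [t] of the two
    quaternionic triples to [l] and [m]. *)
Lemma orientation (M1 M2 M3 : 'M[R]_(4, 7)) (N3 := M1 *m M2^T)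
    (N1 := M2 *m M3^T) (N2 := M3 *m M1^T) (l m s t : R)
    (j1 j2 j3 k1 k2 k3 : 'rV[R]_3) (v : 'rV[R]_4) :
  M1 *m M1^T = 1%:M -> M2 *m M2^T = 1%:M -> N2^T = - N2 -> l + m = 1 ->
  N1 = l *: Lmx j1 + m *: Rmx k1 ->
  N2 = l *: Lmx j2 + m *: Rmx k2 ->
  N3 = l *: Lmx j3 + m *: Rmx k3 ->
  dot j1 j1 = 1 -> dot j3 j3 = 1 ->
  Lmx j3 *m Lmx j2 = s *: Lmx j1 -> Rmx k3 *m Rmx k2 = t *: Rmx k1 ->
  v *m Rmx k1 = v *m Lmx j1 -> v *m Rmx k3 = v *m Lmx j3 -> dot v v = 1 ->
  l * s + m * t = 1.
Proof.
move=> MM1 MM2 sN2 lm e1 e2 e3 n1 n3 J32 K32 vK1 vK3 vv.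
have sq j : dot j j = 1 -> v *m Lmx j *m Lmx j = - v.
  by move=> jj; rewrite -mulmxA LmxMv jj mul_mx_scalar scaleN1r.
have vN3 : v *m N3 = v *m Lmx j3.
  by rewrite e3 mulmxDr -!scalemxAr vK3 -scalerDl lm scale1r.
have vN1 : v *m N1 = v *m Lmx j1.
  by rewrite e1 mulmxDr -!scalemxAr vK1 -scalerDl lm scale1r.
have vJN3 : v *m Lmx j3 *m N3 = - v.
  rewrite e3 mulmxDr -!scalemxAr -(mulmxA v _ (Rmx k3)) LRmxC mulmxA vK3.
  by rewrite -scalerDl lm scale1r sq.
(* The squared length is 1 + 1 - 2, by [dJ], [vv] and [vJN3]. *)
have meet : v *m Lmx j3 *m M1 + v *m M2 = 0.
  have dJ : dot (v *m Lmx j3) (v *m Lmx j3) = 1.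
    by rewrite dot_mulr Lmx_tr mulmxN sq // opprK.
  have iso (M : 'M[R]_(4, 7)) (w u : 'rV[R]_4) : M *m M^T = 1%:M ->
      dot (w *m M) (u *m M) = dot w u.
    by move=> MM; rewrite dot_mulr -mulmxA MM mulmx1.
  apply: dot_eq0; rewrite !dot_lin (dotC (v *m M2)) !iso // dJ vv.
  rewrite dot_mulr -(mulmxA _ M1) -/N3 vJN3 dotNl vv; lra.
have : v *m Lmx j3 *m N2 = v *m N1.
  have := congr1 (fun x => x *m M3^T) meet; rewrite mulmxDl mul0mx -!mulmxA.
  have -> : M1 *m M3^T = - N2 by rewrite -sN2 /N2 trmx_mul trmxK.
  by rewrite -/N1 mulmxN mulmxN => /eqP; rewrite addrC subr_eq0 mulmxA => /eqP.
rewrite vN1 e2 mulmxDr -!scalemxAr -{2}vK3 -!mulmxA J32 K32 -!scalemxAr vK1.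
rewrite !scalerA -scalerDl => /eqP; rewrite -subr_eq0 -[X in _ - X]scale1r.
rewrite -scalerBl scaler_eq0 subr_eq0 => /orP[/eqP //|/eqP vJ].
have := sq _ n1; rewrite vJ mul0mx => /eqP; rewrite eq_sym oppr_eq0 => /eqP v0.
by move: vv; rewrite v0 dotE mul0mx mxE => /eqP; rewrite eq_sym oner_eq0.
Qed.

(** As [l + m = 1], the signs in [orientation] are both 1, unless [l] or [m] is 0,
    in which case [unscale_triple] prescribes the free one.  Hence [Rmx k_i] acts
    as [- Lmx j_i] on [v *m Lmx j2], the first vector of the frame, and the
    parameter is [l - m]. *)
Theorem normal_gram (M1 M2 M3 : 'M[R]_(4, 7)) (N3 := M1 *m M2^T)
    (N1 := M2 *m M3^T) (N2 := M3 *m M1^T) :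
  M1 *m M1^T = 1%:M -> M2 *m M2^T = 1%:M -> M3 *m M3^T = 1%:M ->
  N1^T = - N1 -> N2^T = - N2 -> N3^T = - N3 ->
  exists (g : 'M[R]_4) (t : R), [/\ isSO g, -1 <= t <= 1 &
    [/\ g *m N1 *m g^T = skew4 0 0 (- t) (-1) 0 0,
        g *m N2 *m g^T = skew4 0 (- t) 0 0 1 0 &
        g *m N3 *m g^T = skew4 (- t) 0 0 0 0 (-1)]].
Proof.
move=> MM1 MM2 MM3 sN1 sN2 sN3.
have [l [m [l0 m0 lm tl tm]]] := gram_structure MM1 MM2 MM3 sN1 sN2 sN3.
have one2 : (1 : R) ^+ 2 = 1 by rewrite expr1n.
have mone2 : (- 1 : R) ^+ 2 = 1 by rewrite sqrrN expr1n.
have [j1 [j2 [j3 [s [tj [p1 p2 p3] cj s2 s1]]]]] := unscale_triple l0 one2 tl.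
have [k1 [k2 [k3 [r [tk [q1 q2 q3] ck r2 r1]]]]] := unscale_triple m0 mone2 tm.
have e1 : N1 = l *: Lmx j1 + m *: Rmx k1 by rewrite (selfdual_decomposition sN1) p1 q1 LmxZ RmxZ.
have e2 : N2 = l *: Lmx j2 + m *: Rmx k2 by rewrite (selfdual_decomposition sN2) p2 q2 LmxZ RmxZ.
have e3 : N3 = l *: Lmx j3 + m *: Rmx k3 by rewrite (selfdual_decomposition sN3) p3 q3 LmxZ RmxZ.
have [[nj1 nj2 nj3] [nj12 nj23 nj31]] := tj.
have [[nk1 nk2 nk3] [nk12 nk23 nk31]] := tk.
have nj13 := etrans (dotC _ _) nj31; have nk13 := etrans (dotC _ _) nk31.
have [v [vK1 vK3 vv]] := common_vector nj1 nj3 nj13 nk1 nk3 nk13.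
have J32 : Lmx j3 *m Lmx j2 = s *: Lmx j1.
  by rewrite Lmx_orthoM 1?dotC // crossC LmxN opprK cj LmxZ.
have K32 : Rmx k3 *m Rmx k2 = (- r) *: Rmx k1.
  by rewrite Rmx_orthoM 1?dotC // crossC RmxN ck RmxZ scaleNr.
have or := orientation MM1 MM2 sN2 lm e1 e2 e3 nj1 nj3 J32 K32 vK1 vK3 vv.
have pm (x : R) : x ^+ 2 = 1 -> x = 1 \/ x = -1.
  by move=> /eqP; rewrite sqrf_eq1 => /orP[] /eqP; [left|right].
have sE : s = 1.
  case: (pm _ s2) => // sE; apply: s1.
  by case: (pm _ r2) => rE; move: or l0 m0 lm; rewrite sE rE; lra.
have rE : r = -1.
  case: (pm _ r2) => // rE; apply: r1.
  by move: or l0 m0 lm; rewrite sE rE; lra.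
move: J32 K32; rewrite sE rE opprK !scale1r => J32 K32.
pose f := v *m Lmx j2.
have swap b : f *m Rmx b = v *m Rmx b *m Lmx j2 by rewrite /f -!mulmxA LRmxC.
have JA a b : dot a b = 0 -> v *m Lmx a *m Lmx b = - (v *m Lmx b *m Lmx a).
  by move=> ab; rewrite -mulmxA Lmx_anti // mulmxN mulmxA.
have fK1 : f *m Rmx k1 = - (f *m Lmx j1).
  by rewrite swap vK1 JA.
have fK3 : f *m Rmx k3 = - (f *m Lmx j3).
  by rewrite swap vK3 JA // dotC.
have J13 : Lmx j1 *m Lmx j3 = Lmx j2.
  by rewrite Lmx_anti // -J32 mulmxA LmxMv nj3 mul_scalar_mx scaleN1r opprK.
have K31 : Rmx k3 *m Rmx k1 = - Rmx k2.
  by rewrite -K32 mulmxA RmxMv nk3 mul_scalar_mx scaleN1r.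
have vK2 : v *m Rmx k2 = - (v *m Lmx j2).
  rewrite -[Rmx k2]opprK -K31 mulmxN mulmxA vK3 -mulmxA LRmxC mulmxA vK1.
  by rewrite -mulmxA J13.
have fK2 : f *m Rmx k2 = - (f *m Lmx j2) by rewrite swap vK2 mulNmx.
have ff : dot f f = 1.
  by rewrite dot_mulr Lmx_tr mulmxN -mulmxA LmxMv nj2 mul_mx_scalar scaleN1r opprK.
have [g og [[gJ1 gJ2 gJ3] [gK1 gK2 gK3]]] := quaternion_frame tj J32 ff fK1 fK2 fK3.
have gg : g *m g^T = 1%:M := og.1.
exists g, (l - m); split => //; first by apply/andP; split; lra.
have mE : m = 1 - l by move: lm; lra.
have gE (A B S T : 'M[R]_4) : g *m A = S *m g -> g *m B = T *m g ->
    g *m (l *: A + m *: B) *m g^T = l *: S + m *: T.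
  move=> gA gB; rewrite mulmxDr -!scalemxAr gA gB !scalemxAl -mulmxDl.
  by rewrite -mulmxA gg mulmx1.
split.
- rewrite e1 (gE _ _ _ _ gJ1 gK1).
  by apply/matrixP; apply: ord4P; apply: ord4P; rewrite !mxE /= mE; ring.
- rewrite e2 (gE _ _ _ _ gJ2 gK2).
  by apply/matrixP; apply: ord4P; apply: ord4P; rewrite !mxE /= mE; ring.
- rewrite e3 (gE _ _ _ _ gJ3 gK3).
  by apply/matrixP; apply: ord4P; apply: ord4P; rewrite !mxE /= mE; ring.
Qed.

End NormalGram.

(** * Families with equal Gram matrices *)

Section Householder.
Variables (R : realType) (n : nat).
Implicit Types (u v w : 'rV[R]_n).

Definition reflection w : 'M[R]_n := 1%:M - (2 / dot w w) *: (w^T *m w).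

Lemma mul_reflection u w :
  u *m reflection w = u - (2 * dot u w / dot w w) *: w.
Proof.
rewrite mulmxBr mulmx1 -scalemxAr mulmxA mul_tr_dot mul_scalar_mx scalerA.
by congr (_ - _ *: _); ring.
Qed.

Lemma reflection_isO w : w != 0 -> isO (reflection w).
Proof.
move=> w0; have ww : dot w w != 0 by apply: contraNneq w0 => /dot_eq0 ->.
rewrite /isO linearB /= trmx1 linearZ /= trmx_mul trmxK.
rewrite mulmxBr mulmx1 mulmxBl mul1mx -scalemxAl -!scalemxAr.
rewrite -mulmxA (mulmxA w) mul_tr_dot mul_scalar_mx -scalemxAr !scalerA.
rewrite (_ : 2 / dot w w * _ = 2 / dot w w *+ 2); last by rewrite mulr2n; field.
by rewrite mulr2n scalerDl opprB addrK subrK.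
Qed.

(** One row after the other is moved into place by a reflection, which fixes the
    rows already treated, as they have the same inner product with the row to be
    moved and with its target. *)
Lemma gram_orthogonal m (X Y : 'M[R]_(m, n)) : X *m X^T = Y *m Y^T ->
  exists2 C : 'M[R]_n, isO C & X *m C = Y.
Proof.
move=> XY.
have gram i j : dot (row i X) (row j X) = dot (row i Y) (row j Y).
  by rewrite !dotE !tr_row !colE !mulmxA -!row_mul XY.
suff H k : exists2 C : 'M[R]_n, isO C &
    forall i : 'I_m, (i < k)%N -> row i X *m C = row i Y.
  by have [C oC hC] := H m; exists C => //; apply/row_matrixP => i; rewrite row_mul hC.
elim: k => [|k [C oC hC]]; first by exists 1%:M => //; exact: isO1.
have [km|km] := ltnP k m; last first.
  by exists C => // i _; apply: hC; exact: leq_trans (ltn_ord i) km.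
pose x := row (Ordinal km) X *m C; pose y := row (Ordinal km) Y.
have [xy|xy] := eqVneq x y.
  exists C => // i; rewrite ltnS leq_eqVlt => /orP[/eqP ik|/hC //].
  by rewrite (_ : i = Ordinal km) //; apply: val_inj.
have iso u v : dot (u *m C) (v *m C) = dot u v.
  by rewrite dot_mulr -mulmxA oC mulmx1.
have xx : dot x x = dot y y by rewrite iso gram.
have w0 : x - y != 0 by rewrite subr_eq0.
exists (C *m reflection (x - y)).
  by apply: isO_mul => //; exact: reflection_isO.
move=> i; rewrite ltnS leq_eqVlt mulmxA => /orP[/eqP ik|ik].
  rewrite (_ : i = Ordinal km); last exact: val_inj.
  rewrite -/x -/y mul_reflection.
  have -> : dot (x - y) (x - y) = 2 * dot x (x - y).
    rewrite !dot_lin (dotC y) xx; ring.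
  rewrite divff ?scale1r ?subKr //.
  by apply: contraNneq w0 => h; apply/eqP/dot_eq0; rewrite !dot_lin (dotC y) xx;
    move: h; rewrite !dot_lin xx; lra.
rewrite (hC _ ik) mul_reflection.
have -> : dot (row i Y) (x - y) = 0.
  by rewrite !dot_lin -{1}(hC _ ik) iso gram subrr.
by rewrite mulr0 mul0r scale0r subr0.
Qed.

End Householder.

(** * The slices of an orthogonal multiplication *)

Section OrthMult.
Variables (R : realType) (p : nat).
Implicit Types (F : mult34 R p).

Definition slice F (i : 'I_3) : 'M[R]_(4, p) :=
  \matrix_(a < 4) F (delta_mx 0 i) (delta_mx 0 a).

Definition gram F i k : 'M[R]_4 := slice F i *m (slice F k)^T.

Lemma gramE F i k a b : gram F i k a b =
  dot (F (delta_mx 0 i) (delta_mx 0 a)) (F (delta_mx 0 k) (delta_mx 0 b)).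
Proof. by rewrite mxE; apply: eq_bigr => j _; rewrite !mxE. Qed.

Lemma om_linear F (x : 'rV[R]_3) : orth_mult F -> linear (F x).
Proof. by move=> [[_ l] _] a u v; exact: l. Qed.

Lemma om_linearl F (y : 'rV[R]_4) : orth_mult F -> linear (fun x => F x y).
Proof. by move=> [[l _] _] a u v; exact: l. Qed.

Lemma linear_sum_delta n (f : 'rV[R]_n -> 'rV[R]_p) (x : 'rV[R]_n) : linear f ->
  f x = \sum_j x 0 j *: f (delta_mx 0 j).
Proof.
move=> lf.
pose fl : {linear 'rV[R]_n -> 'rV[R]_p} :=
  HB.pack f (GRing.isLinear.Build R _ _ _ f lf).
rewrite -[f]/(fl : _ -> _) {1}(row_sum_delta x) linear_sum.
by apply: eq_bigr => j _; rewrite linearZ.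
Qed.

Lemma om_slices F x y : orth_mult F -> F x y = \sum_i x 0 i *: (y *m slice F i).
Proof.
move=> oF; rewrite (linear_sum_delta x (om_linearl y oF)).
apply: eq_bigr => i _; congr (_ *: _).
rewrite (linear_sum_delta y (om_linear _ oF)) mulmx_sum_row.
by apply: eq_bigr => j _; rewrite rowK.
Qed.

Lemma om_dot F x y : orth_mult F -> dot (F x y) (F x y) = dot x x * dot y y.
Proof.
move=> [_ nF]; have := congr1 (fun z => z ^+ 2) (nF x y).
by rewrite /enorm exprMn !sqr_sqrtr ?dot_ge0.
Qed.

Lemma omDl F x x' y : orth_mult F -> F (x + x') y = F x y + F x' y.
Proof. by move=> oF; have := om_linearl y oF 1 x x'; rewrite !scale1r. Qed.

Lemma omDr F x y y' : orth_mult F -> F x (y + y') = F x y + F x y'.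
Proof. by move=> oF; have := om_linear x oF 1 y y'; rewrite !scale1r. Qed.

Lemma om_polar F x y y' : orth_mult F ->
  dot (F x y) (F x y') = dot x x * dot y y'.
Proof.
move=> oF; have := om_dot x (y + y') oF.
rewrite omDr // !dot_lin !(om_dot _ _ oF) (dotC (F x y')) (dotC y'); lra.
Qed.

Lemma om_polar2 F x x' y y' : orth_mult F ->
  dot (F x y) (F x' y') + dot (F x y') (F x' y) = 2 * dot x x' * dot y y'.
Proof.
move=> oF; have := om_polar (x + x') y y' oF.
rewrite !omDl // !dot_lin !(om_polar _ _ _ oF) (dotC (F x' y)) (dotC x'); lra.
Qed.

Lemma gram_diag F i : orth_mult F -> gram F i i = 1%:M.
Proof.
move=> oF; apply/matrixP => a b; rewrite gramE om_polar // !dot_delta eqxx.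
by rewrite mul1r !mxE.
Qed.

Lemma gram_skew F i k : orth_mult F -> i != k -> (gram F i k)^T = - gram F i k.
Proof.
move=> oF ik; apply/matrixP => a b; rewrite mxE [RHS]mxE !gramE.
have := om_polar2 (delta_mx 0 i) (delta_mx 0 k) (delta_mx 0 a) (delta_mx 0 b) oF.
by rewrite !dot_delta (negPf ik) mulr0 mul0r => /eqP; rewrite addrC addr_eq0 => /eqP.
Qed.

Lemma gram_tr F i k : (gram F i k)^T = gram F k i.
Proof. by rewrite /gram trmx_mul trmxK. Qed.

Lemma om_comp F (A : 'M[R]_3) (B : 'M[R]_4) : isO A -> isO B -> orth_mult F ->
  orth_mult (fun x y => F (x *m A) (y *m B)).
Proof.
move=> oA oB oF; split.
  split=> z a u v /=; rewrite mulmxDl -scalemxAl.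
    exact: (om_linearl (z *m B) oF).
  exact: (om_linear (z *m A) oF).
move=> x y; rewrite oF.2 /enorm !dot_mulr -!mulmxA oA oB !mulmx1.
by [].
Qed.

End OrthMult.

(** * The one-parameter model *)

Section Model.
Variable R : realType.

(** The reversed order matches the frames of [normal_gram]. *)
Definition im (y : 'rV[R]_4) : 'rV[R]_3 :=
  vec3 (y 0 (o4 3)) (y 0 (o4 2)) (y 0 (o4 1)).

Lemma im_linear a u v : im (a *: u + v) = a *: im u + im v.
Proof. by apply/rowP; apply: ord3P; rewrite !mxE. Qed.

Lemma dot_re_im y : dot y y = y 0 (o4 0) ^+ 2 + dot (im y) (im y).
Proof. by rewrite /dot sum4 sum3 !mxE /=; ring. Qed.

Definition glue (a : R) (u v : 'rV[R]_3) : 'rV[R]_7 :=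
  row_mx a%:M (row_mx u v) : 'rV_(1 + (3 + 3)).

Lemma glueD a a' u u' v v' :
  glue a u v + glue a' u' v' = glue (a + a') (u + u') (v + v').
Proof.
by rewrite /glue raddfD /= -!add_row_mx.
Qed.

Lemma glueZ k a u v : k *: glue a u v = glue (k * a) (k *: u) (k *: v).
Proof.
by rewrite /glue -scale_scalar_mx -!scale_row_mx.
Qed.

Lemma glue_dot a a' u u' v v' :
  dot (glue a u v) (glue a' u' v') = a * a' + dot u u' + dot v v'.
Proof.
by apply: (etrans (@dot_row_mx R 1 (3 + 3) _ _ _ _)); rewrite dot_scalar dot_row_mx addrA.
Qed.

(** In quaternions, with x imaginary, w = Im y and s = Re y, the vectors xy and
    yx have the parts - x.w, s x + cross x w and s x - cross x w.  The map
    (sqrt m xy, sqrt l yx), with l + m = 1, takes its values in a space of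
    dimension 7 and is the model at t = l - m, up to an isometry of the range. *)
Definition model (t : R) : mult34 R 7 := fun x y =>
  glue (dot x (im y)) (y 0 (o4 0) *: x - t *: cross x (im y))
    (Num.sqrt (1 - t ^+ 2) *: cross x (im y)).

Lemma model_dot t x y x' y' : -1 <= t <= 1 ->
  dot (model t x y) (model t x' y') =
  dot x (im y) * dot x' (im y') + y 0 (o4 0) * y' 0 (o4 0) * dot x x'
  - t * (y 0 (o4 0) * dot x (cross x' (im y')) + y' 0 (o4 0) * dot x' (cross x (im y)))
  + dot (cross x (im y)) (cross x' (im y')).
Proof.
move=> /andP[t1 t2].
have rE : Num.sqrt (1 - t ^+ 2) ^+ 2 = 1 - t ^+ 2 by rewrite sqr_sqrtr //; nra.
rewrite glue_dot !dot_lin.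
rewrite [Num.sqrt _ * (_ * _)]mulrA -expr2 rE (dotC (cross x _) x'); ring.
Qed.

Lemma model_orth_mult t : -1 <= t <= 1 -> orth_mult (model t).
Proof.
move=> t1; split; first split=> z a u v /=.
- rewrite glueZ glueD /model dot_lin crossDl dotZl crossZl.
  by congr glue; apply/rowP => i; rewrite !mxE; ring.
- rewrite glueZ glueD /model im_linear dot_lin crossDr dotZr crossZr.
  by congr glue; apply/rowP => i; rewrite !mxE; ring.
move=> x y; rewrite /enorm -sqrtrM ?dot_ge0 //; congr Num.sqrt.
by rewrite model_dot // dot_cross lagrange dot_re_im; ring.
Qed.

Lemma model_gram t : -1 <= t <= 1 ->
  [/\ gram (model t) (o3 1) (o3 2) = skew4 0 0 (- t) (-1) 0 0,
      gram (model t) (o3 2) (o3 0) = skew4 0 (- t) 0 0 1 0 &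
      gram (model t) (o3 0) (o3 1) = skew4 (- t) 0 0 0 0 (-1)].
Proof.
move=> t1; have om := model_orth_mult t1.
have E i k : i != k -> gram (model t) i k = skew4 
    (gram (model t) i k (o4 0) (o4 1)) (gram (model t) i k (o4 0) (o4 2))
    (gram (model t) i k (o4 0) (o4 3)) (gram (model t) i k (o4 1) (o4 2))
    (gram (model t) i k (o4 1) (o4 3)) (gram (model t) i k (o4 2) (o4 3)).
  by move=> ik; exact: skew4E (gram_skew om ik).
have dE : (delta_mx 0 (o3 0) = vec3 1 0 0 :> 'rV[R]_3) *
    (delta_mx 0 (o3 1) = vec3 0 1 0 :> 'rV[R]_3) *
    (delta_mx 0 (o3 2) = vec3 0 0 1 :> 'rV[R]_3).
  by split; [split|]; apply/rowP; apply: ord3P; rewrite !mxE.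
have iE : (im (delta_mx 0 (o4 0)) = vec3 0 0 0) * (im (delta_mx 0 (o4 1)) = vec3 0 0 1) *
    (im (delta_mx 0 (o4 2)) = vec3 0 1 0) * (im (delta_mx 0 (o4 3)) = vec3 1 0 0).
  by split; [split; [split|]|]; apply/rowP; apply: ord3P; rewrite !mxE.
have sE a : (delta_mx 0 a : 'rV[R]_4) 0 (o4 0) = (a == o4 0)%:R by rewrite mxE eq_sym.
by split; rewrite E; try (by []); congr skew4;
  rewrite gramE (model_dot _ _ _ _ t1) !iE !sE !dE !cross_vec3 !dot_vec3 /=; ring.
Qed.

(** The parameter of the normal form, as a polynomial in the values of [F]. *)
Definition invariant (F : mult34 R 7) : R := pf (gram F (o3 0) (o3 1)).

Lemma normal_form F : orth_mult F ->
  -1 <= invariant F <= 1 /\ om_equiv F (model (invariant F)).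
Proof.
move=> oF.
have [||||||g [t [og t1 [g1 g2 g3]]]] := @normal_gram _
    (slice F (o3 0)) (slice F (o3 1)) (slice F (o3 2));
  try exact: (gram_diag _ oF); try by apply: (gram_skew oF).
have tE : t = invariant F.
  have := pf_conj g (gram_skew oF (isT : o3 0 != o3 1)).
  rewrite [gram _ _ _]/(slice _ _ *m _) g3 og.2 mul1r /invariant => <-.
  by rewrite /pf !mxE /=; ring.
rewrite -tE; split => //.
have om := model_orth_mult t1; have [m1 m2 m3] := model_gram t1.
pose X := col_mx (g *m slice F (o3 0)) (col_mx (g *m slice F (o3 1)) (g *m slice F (o3 2))).
pose M := model t.
pose Y := col_mx (slice M (o3 0)) (col_mx (slice M (o3 1)) (slice M (o3 2))).
have conj i k : g *m slice F i *m (g *m slice F k)^T = g *m gram F i k *m g^T.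
  by rewrite trmx_mul !mulmxA.
have diag i : g *m gram F i i *m g^T = gram M i i.
  by rewrite !gram_diag // mulmx1 og.1.
have G12 : g *m gram F (o3 1) (o3 2) *m g^T = gram M (o3 1) (o3 2) by rewrite m1.
have G20 : g *m gram F (o3 2) (o3 0) *m g^T = gram M (o3 2) (o3 0) by rewrite m2.
have G01 : g *m gram F (o3 0) (o3 1) *m g^T = gram M (o3 0) (o3 1) by rewrite m3.
have sym i k : g *m gram F i k *m g^T = gram M i k -> g *m gram F k i *m g^T = gram M k i.
  by move=> /(congr1 trmx); rewrite trmx_mul trmxK trmx_mul !gram_tr mulmxA.
have XY : X *m X^T = Y *m Y^T.
  rewrite /X /Y !tr_col_mx !mul_col_row !mul_mx_row !mul_col_mx !conj.
  rewrite -!/(gram _ _ _) !diag G12 G20 G01.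
  by rewrite (sym _ _ G12) (sym _ _ G20) (sym _ _ G01).
have [C oC] := gram_orthogonal XY.
rewrite /X /Y !mul_col_mx => /eq_col_mx[c0 /eq_col_mx[c1 c2]].
have hC : forall i, g *m slice F i *m C = slice M i by exact: ord3P.
exists 1%:M, g, C; split => //; first by split; [exact: isO1 | exact: det1].
move=> x y; rewrite (om_slices _ _ om) (om_slices _ _ oF) mulmx1 mulmx_suml.
by apply: eq_bigr => i _; rewrite -hC -scalemxAl !mulmxA.
Qed.

End Model.

(** * Invariance, normalized frames and fullness *)

Section Invariance.
Variable R : realType.
Implicit Types F G : mult34 R 7.

Lemma dot_triple (c x y z : R) (u v w : 'rV[R]_3) : scaled_triple c u v w ->
  dot (x *: u + y *: v + z *: w) (x *: u + y *: v + z *: w) =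
  c * (x ^+ 2 + y ^+ 2 + z ^+ 2).
Proof.
move=> [[uu vv ww] [uv vw wu]].
by rewrite !dot_lin uu vv ww (dotC v u) (dotC w v) (dotC u w) uv vw wu; ring.
Qed.

Lemma om_gram_structure F : orth_mult F ->
  exists l m : R, [/\ 0 <= l, 0 <= m, l + m = 1,
    scaled_triple (l ^+ 2) (selfdual (gram F (o3 1) (o3 2)))
      (selfdual (gram F (o3 2) (o3 0)))
      (selfdual (gram F (o3 0) (o3 1))) &
    scaled_triple (m ^+ 2) (antiselfdual (gram F (o3 1) (o3 2)))
      (antiselfdual (gram F (o3 2) (o3 0)))
      (antiselfdual (gram F (o3 0) (o3 1)))].
Proof.
move=> oF; apply: gram_structure; try exact: (gram_diag _ oF);
  exact: (gram_skew oF).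
Qed.

(** The three Gram matrices transform as the coordinates of the normal vector
    [n] of the plane spanned by the first two basis vectors. *)
Lemma gram_pullback F (A : 'M[R]_3) (B : 'M[R]_4) : orth_mult F -> isO A ->
  let n := cross (row (o3 0) A) (row (o3 1) A) in
  gram (fun x y => F (x *m A) (y *m B)) (o3 0) (o3 1) =
  B *m (n 0 (o3 0) *: gram F (o3 1) (o3 2) + n 0 (o3 1) *: gram F (o3 2) (o3 0)
        + n 0 (o3 2) *: gram F (o3 0) (o3 1)) *m B^T.
Proof.
move=> oF oA n.
have sl i : slice (fun x y => F (x *m A) (y *m B)) i =
    B *m \sum_j A i j *: slice F j.
  apply/row_matrixP => a; rewrite rowK -!rowE (om_slices _ _ oF) row_mul mulmx_sumr.
  by apply: eq_bigr => j _; rewrite mxE -scalemxAr.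
rewrite /gram !sl trmx_mul !mulmxA; congr (_ *m _); rewrite -mulmxA; congr (_ *m _).
have nE : (n 0 (o3 0) = A (o3 0) (o3 1) * A (o3 1) (o3 2) - A (o3 0) (o3 2) * A (o3 1) (o3 1)) *
    (n 0 (o3 1) = A (o3 0) (o3 2) * A (o3 1) (o3 0) - A (o3 0) (o3 0) * A (o3 1) (o3 2)) *
    (n 0 (o3 2) = A (o3 0) (o3 0) * A (o3 1) (o3 1) - A (o3 0) (o3 1) * A (o3 1) (o3 0)).
  by rewrite /n !mxE /=.
rewrite !nE {n nE}.
have := isO_rows (o3 0) (o3 1) oA; rewrite /dot sum3 !mxE /= => ort.
have tD (X Y : 'M[R]_(4, 7)) : (X + Y)^T = X^T + Y^T by rewrite linearD.
have tZ a (X : 'M[R]_(4, 7)) : (a *: X)^T = a *: X^T by rewrite linearZ.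
rewrite !sum3 !tD !tZ !mulmxDl !mulmxDr.
rewrite -!scalemxAl -!scalemxAr.
rewrite -!/(gram _ _ _) !gram_diag //.
rewrite -(gram_tr F (o3 0) (o3 1)) -(gram_tr F (o3 1) (o3 2)) -(gram_tr F (o3 2) (o3 0)).
rewrite !gram_skew //.
apply/matrixP => a b; rewrite !mxE /=.
apply/eqP; rewrite -subr_eq0; apply/eqP.
transitivity ((A (o3 0) (o3 0) * A (o3 1) (o3 0) + A (o3 0) (o3 1) * A (o3 1) (o3 1)
  + A (o3 0) (o3 2) * A (o3 1) (o3 2)) * (a == b)%:R); last by rewrite ort mul0r.
ring.
Qed.

(** By [gram_structure] the Pfaffian is the same, [l ^+ 2 - m ^+ 2], for every unit
    normal, so it is unaffected by the rotation of R^3. *)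
Lemma invariant_equiv F G : orth_mult F -> om_equiv F G -> invariant G = invariant F.
Proof.
move=> oF [A [B [C [[oA _] [oB dB] oC GE]]]].
have -> : invariant G = pf (gram (fun x y => F (x *m A) (y *m B)) (o3 0) (o3 1)).
  by congr pf; apply/matrixP => a b; rewrite !gramE !GE isO_dot.
rewrite (gram_pullback _ oF oA); set n := cross _ _; set N := _ + _ + _.
have sN : N^T = - N.
  by rewrite /N !linearD /= !linearZ /= !gram_skew // !scalerN -!opprD.
have nn : dot n n = 1 by rewrite lagrange !isO_rows //=; ring.
rewrite pf_conj // dB mul1r /invariant !pf_selfdual.
rewrite /N !selfdualD !antiselfdualD !selfdualZ !antiselfdualZ.
have [l [m [_ _ _ sp ap]]] := om_gram_structure oF.
have [[_ _ s3] _] := sp; have [[_ _ a3] _] := ap.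
rewrite (dot_triple _ _ _ sp) (dot_triple _ _ _ ap) s3 a3.
rewrite -[RHS]mulr1 -nn /dot sum3; ring.
Qed.

Lemma FcE F A B i j k l : Fc F A B i j k l =
  gram (fun x y => F (x *m A) (y *m B)) (inord i.-1) (inord k.-1)
    (inord j.-1) (inord l.-1).
Proof. by rewrite gramE -!rowE. Qed.

Lemma inord3 : (inord 0 = o3 0) * (inord 1 = o3 1) * (inord 2 = o3 2).
Proof. by split; [split|]; apply: val_inj; rewrite /= inordK. Qed.
Lemma inord4 : (inord 0 = o4 0) * (inord 1 = o4 1) * (inord 2 = o4 2) * (inord 3 = o4 3).
Proof. by split; [split; [split|]|]; apply: val_inj; rewrite /= inordK. Qed.

(** The standard frame of the model is normalized. *)
Lemma exists_normalized F : orth_mult F ->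
  exists A B, [/\ isSO A, isSO B & normalized F A B].
Proof.
move=> oF; have [t1 [A [B [C [oA oB oC mE]]]]] := normal_form oF.
exists A, B; split => //; set t := invariant F in t1 mE.
have gE i k : gram (fun x y => F (x *m A) (y *m B)) i k = gram (model t) i k.
  by apply/matrixP => a b; rewrite !gramE !mE isO_dot.
have om := model_orth_mult t1; have [g1 g2 g3] := model_gram t1.
have g4 : gram (model t) (o3 2) (o3 1) = - gram (model t) (o3 1) (o3 2).
  by rewrite -gram_tr gram_skew.
rewrite /normalized !FcE !gE /= !inord3 !inord4 g4 g1 g2 g3 !mxE /=.
by do !split; ring.
Qed.

(** The vectors [(0, 0, x)], [(0, y2, y3)] and [(z1, z2, z3)] are orthogonal and of
    the same length, hence a triangular orthogonal matrix up to a factor. *)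
Lemma triangular_triple (c x y2 y3 z1 z2 z3 : R) :
  x ^+ 2 = c -> y2 ^+ 2 + y3 ^+ 2 = c -> z1 ^+ 2 + z2 ^+ 2 + z3 ^+ 2 = c ->
  x * y3 = 0 -> y2 * z2 + y3 * z3 = 0 -> z3 * x = 0 ->
  [/\ y3 = 0, z2 = 0 & z3 = 0].
Proof.
move=> xc yc zc xy yz zx; have [x0|x0] := eqVneq x 0.
  have c0 : c = 0 by rewrite -xc x0 expr0n.
  by split; apply/eqP; rewrite -sqrf_eq0; apply/eqP; nra.
move: xy zx => /eqP; rewrite mulf_eq0 (negPf x0) /= => /eqP y30 /eqP.
rewrite mulf_eq0 (negPf x0) orbF => /eqP z30; split => //.
move: yz; rewrite y30 mul0r addr0 => /eqP; rewrite mulf_eq0 => /orP[/eqP y20|/eqP //].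
by move: yc; rewrite y20 y30 expr0n addr0 -xc => /eqP; rewrite eq_sym sqrf_eq0 (negPf x0).
Qed.

(** Normalization makes the anti-self-dual parts of the three Gram matrices a
    triangular system, to which [triangular_triple] applies. *)
Lemma normalized_degenerate F A B : orth_mult F -> isO A -> isO B ->
  normalized F A B -> degenerate F A B.
Proof.
move=> oF oA oB; have oF' := om_comp oA oB oF.
rewrite /degenerate /beta /normalized !FcE /= !inord3 !inord4.
set F' := (fun x y => _) in oF' *.
rewrite -(gram_tr F' (o3 1) (o3 2)).
have [l [m [_ _ _ _]]] := om_gram_structure oF'.
have s1 := skewE (gram_skew oF' (isT : o3 1 != o3 2)).
have s2 := skewE (gram_skew oF' (isT : o3 2 != o3 0)).
have s3 := skewE (gram_skew oF' (isT : o3 0 != o3 1)).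
move: (gram F' (o3 1) (o3 2)) (gram F' (o3 2) (o3 0)) (gram F' (o3 0) (o3 1)) s1 s2 s3.
move=> N1 N2 N3 s1 s2 s3; rewrite /scaled_triple /dot !sum3 !mxE /=.
rewrite (s1 (o4 0) (o4 1)) (s1 (o4 2) (o4 3)) (s1 (o4 0) (o4 2)) (s3 (o4 1) (o4 3))
  (s3 (o4 0) (o4 3)).
move=> [[n1 n2 n3] [n12 n23 n31]] [[z1 z2] [[z3 z4] [[z5 z6] [z7 [z8 z9]]]]].
move/eqP: z3; rewrite oppr_eq0 => /eqP z3; move/eqP: z4; rewrite oppr_eq0 => /eqP z4.
move/eqP: z5; rewrite oppr_eq0 => /eqP z5.
have {}z7 : N3 (o4 0) (o4 2) = N3 (o4 1) (o4 3) by move: z7; lra.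
have {}z8 : N3 (o4 1) (o4 2) = - N3 (o4 0) (o4 3) by move: z8; lra.
have {}z9 : N2 (o4 1) (o4 2) = - N2 (o4 0) (o4 3) by move: z9; lra.
move: n1 n2 n3 n12 n23 n31; rewrite z1 z2 z3 z4 z5 z6 z7 z8 z9 => n1 n2 n3 n12 n23 n31.
pose x := (N1 (o4 0) (o4 3) - N1 (o4 1) (o4 2)) / 2.
have [||||||-> -> ->] := @triangular_triple (m ^+ 2) x
  (N2 (o4 0) (o4 2) / 2 + N2 (o4 1) (o4 3) / 2) (N2 (o4 0) (o4 3))
  ((N3 (o4 0) (o4 1) - N3 (o4 2) (o4 3)) / 2) (N3 (o4 1) (o4 3)) (N3 (o4 0) (o4 3)).
- by rewrite /x; lra.
- by lra.
- by lra.
- by rewrite /x; lra.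
- by lra.
- by rewrite /x; lra.
- by rewrite !oppr0.
Qed.

Lemma full_orthogonal (F : mult34 R 7) (c : 'rV[R]_7) : full F ->
  (forall x y, dot (F x y) c = 0) -> c = 0.
Proof.
move=> fF Fc; apply: dot_eq0.
have /fF kerE : forall x y, F x y \in lker (linfun (mulmxr c^T)).
  by move=> x y; rewrite memv_ker lfunE /= mul_tr_dot Fc raddf0.
have : c \in lker (linfun (mulmxr c^T)) by rewrite kerE memvf.
by rewrite memv_ker lfunE /= => /eqP; rewrite dotE => ->; rewrite mxE.
Qed.

(** At [t = 1] and [t = -1] the last three coordinates of the model vanish. *)
Lemma full_invariant F : orth_mult F -> full F -> -1 < invariant F < 1.
Proof.
move=> oF fF; have [/andP[t1 t2] e] := normal_form oF.
suff tn : invariant F ^+ 2 != 1.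
  rewrite !lt_neqAle t1 t2 !andbT; apply/andP; split.
    by apply: contraNneq tn => <-; rewrite sqrrN expr1n.
  by apply: contraNneq tn => ->; rewrite expr1n.
apply/eqP => tt; have [A [B [C [oA oB oC FE]]]] := om_equiv_sym e.
pose c := glue 0 0 (vec3 1 0 0 : 'rV[R]_3) *m C.
have cc : dot c c = 1.
  by rewrite isO_dot // glue_dot dot_vec3 dot0l; ring.
have c0 : c = 0.
  apply: (full_orthogonal fF) => x y; rewrite FE isO_dot // glue_dot tt subrr.
  by rewrite sqrtr0 scale0r mulr0 dot0l dot0r !addr0.
by move: cc; rewrite c0 dot0l => /eqP; rewrite eq_sym oner_eq0.
Qed.

Lemma model_full (t : R) : -1 < t < 1 -> full (model t).
Proof.
move=> /andP[t1 t2] U FU.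
have U1 u : glue 0 u 0 \in U.
  have := FU u (delta_mx 0 (o4 0)); rewrite /model.
  have -> : im (delta_mx 0 (o4 0) : 'rV[R]_4) = 0.
    by apply/rowP; apply: ord3P; rewrite !mxE.
  rewrite mxE /= scale1r.
  have -> : cross u 0 = 0 by apply/rowP; apply: ord3P; rewrite !mxE /=; ring.
  by rewrite !scaler0 subr0 dot0r.
have U2 (x : 'rV[R]_3) (y : 'rV[R]_4) : y 0 (o4 0) = 0 ->
    dot x (im y) = 0 -> glue 0 0 (cross x (im y)) \in U.
  move=> y0 xy; set r := Num.sqrt (1 - t ^+ 2).
  have r0 : r != 0.
    rewrite gt_eqF // sqrtr_gt0; nra.
  have := memvD (FU x y) (U1 (t *: cross x (im y))).
  rewrite /model y0 xy scale0r sub0r glueD addr0 addNr addr0 => /(memvZ r^-1).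
  by rewrite glueZ mulr0 scaler0 scalerA mulVf // scale1r.
have imE a b c : im (\row_i nth 0 [:: 0; c; b; a] i) = vec3 a b c :> 'rV[R]_3.
  by apply/rowP; apply: ord3P; rewrite !mxE.
have U3 a : glue a 0 0 \in U.
  have := FU (vec3 a 0 0) (\row_i nth 0 [:: 0; 0; 0; 1] i).
  rewrite /model imE cross_vec3 dot_vec3 mxE /= scale0r.
  rewrite (_ : vec3 _ _ _ = 0); last by apply/rowP; apply: ord3P; rewrite !mxE /=; ring.
  by rewrite !scaler0 subr0 mulr1 !mulr0 !addr0.
have U4 v : glue 0 0 v \in U.
  pose w a b c : 'rV[R]_4 := \row_i nth 0 [:: 0; c; b; a] i.
  have w0 a b c : w a b c 0 (o4 0) = 0 by rewrite mxE.
  have := memvD (memvD (U2 (vec3 0 1 0) (w 0 0 (v 0 (o3 0))) (w0 _ _ _) _)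
    (U2 (vec3 0 0 1) (w (v 0 (o3 1)) 0 0) (w0 _ _ _) _))
    (U2 (vec3 1 0 0) (w 0 (v 0 (o3 2)) 0) (w0 _ _ _) _).
  rewrite !imE !cross_vec3 !dot_vec3 !glueD !addr0.
  rewrite (_ : _ + _ + _ = v).
    by apply; ring.
  by apply/rowP; apply: ord3P; rewrite !mxE /=; ring.
apply/vspaceP => z; rewrite memvf.
have -> : z = glue (lsubmx (z : 'rV_(1 + (3 + 3))) 0 0)
   (lsubmx (rsubmx (z : 'rV_(1 + (3 + 3))))) (rsubmx (rsubmx (z : 'rV_(1 + (3 + 3))))).
  by rewrite /glue -mx11_scalar !hsubmxK.
have := memvD (memvD (U3 (lsubmx (z : 'rV_(1 + (3 + 3))) 0 0))
  (U1 (lsubmx (rsubmx (z : 'rV_(1 + (3 + 3)))))))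
  (U4 (rsubmx (rsubmx (z : 'rV_(1 + (3 + 3)))))).
by rewrite !glueD !addr0 !add0r.
Qed.

End Invariance.

(** * Covering dimension of the line *)

Local Open Scope classical_set_scope.
Local Open Scope card_scope.

Section Card.

Lemma card_le2 T (A : set T) (a b : T) : A `<=` [set a; b] -> A #<= `I_2.
Proof.
move=> Aab; pose f (n : nat) := if n == 0%N then a else b.
apply: (@card_le_trans _ _ _ (f @` `I_2)); last exact: card_image_le.
apply: subset_card_le => x /Aab[] ->; first by exists 0%N.
by exists 1%N.
Qed.

Lemma card_le1_eq T (A : set T) (x y : T) : A #<= `I_1 -> A x -> A y -> x = y.
Proof.
move=> /pcard_leP[f] Ax Ay.
have zero z : A z -> f z = 0%N.
  by move=> Az; have := @funS _ _ _ _ f z Az => /=; rewrite ltnS leqn0 => /eqP.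
by apply: (@inj _ _ _ f); rewrite ?inE //; exact: etrans (zero x Ax) (esym (zero y Ay)).
Qed.

End Card.

Section Line.
Variable R : realType.

(** A point lies in at most one member of each of the two disjoint families. *)
Lemma disjoint_families_card (T : Type) (V W : set (set T)) :
  (forall A B x, V A -> V B -> A x -> B x -> A = B) ->
  (forall A B x, W A -> W B -> A x -> B x -> A = B) ->
  forall x, [set A | (V `|` W) A /\ A x] #<= `I_2.
Proof.
move=> dV dW x.
pose a := xget set0 [set A | V A /\ A x]; pose b := xget set0 [set A | W A /\ A x].
apply: (@card_le2 _ _ a b) => A [[VA|WA] Ax]; [left|right].
  rewrite /a; case: xgetP => [B _ [VB Bx]|/(_ A)]; first exact: dV Ax Bx.
  by case.
rewrite /b; case: xgetP => [B _ [WB Bx]|/(_ A)]; first exact: dW Ax Bx.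
by case.
Qed.

(** Every point lies in a largest half-open dyadic interval, of length at most 1,
    whose closure is contained in a member of the covering.  These tiles form a
    partition, and their left endpoints are isolated from each other, as the
    tiles near a point have lengths bounded below.  The interiors of the
    tiles form one family, small balls around the left endpoints the other. *)
Lemma covdim_le_line : covdim_le R 1.
Proof.
move=> U [Uo Ucov].
(* [k n x] numbers the dyadic interval of length 2^-n that contains [x]. *)
pose k n (x : R) := Num.floor (2 ^+ n * x).
pose cell n (j : int) := [set y : R | j%:~R <= 2 ^+ n * y <= (j + 1)%:~R].
pose good n j := exists2 A, U A & cell n j `<=` A.
have p2 n : 0 < 2 ^+ n :> R by rewrite exprn_gt0.
have kP n x : (k n x)%:~R <= 2 ^+ n * x < (k n x + 1)%:~R by exact: floor_itv.
have kE n x j : j%:~R <= 2 ^+ n * x < (j + 1)%:~R -> k n x = j by exact: floor_def.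
(* Every sufficiently short dyadic interval near [x] is good. *)
have small x : exists n, exists2 e, 0 < e &
    forall m y, (n <= m)%N -> `|y - x| < e -> good m (k m y).
  have [A UA Ax] : exists2 A, U A & A x.
    by have : (\bigcup_(A in U) A) x by rewrite Ucov.
  have /(nbhs_ballP x)[e /= e0 xeA] : nbhs x A.
    by apply: open_nbhs_nbhs; split => //; exact: Uo.
  have [n ne] : exists n, 2 < 2 ^+ n * e.
    exists (Num.bound (2 / e)); rewrite -ltr_pdivrMr //.
    apply: (@lt_le_trans _ _ (Num.bound (2 / e))%:R).
      by apply: archi_boundP; rewrite divr_ge0 // ltW.
    by rewrite -natrX ler_nat ltnW // ltn_expl.
  exists n, (e / 2); first by rewrite divr_gt0.
  move=> m y nm yx; exists A => // z /andP[z1 z2]; apply: xeA.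
  rewrite /ball /= distrC.
  have [y1 y2] := andP (kP m y).
  have mn : 2 ^+ n <= 2 ^+ m :> R by rewrite ler_eXn2l // ltr1n.
  have zy : 2 ^+ m * `|z - y| <= 1.
    rewrite -[2 ^+ m]gtr0_norm // -normrM mulrBr ler_norml.
    move: y1 y2 z1 z2; rewrite intrD /=; lra.
  have : 2 ^+ m * `|z - y| < 2 ^+ m * (e / 2).
    apply: le_lt_trans zy _; have : 2 ^+ n * e <= 2 ^+ m * e by rewrite ler_pM2r.
    lra.
  rewrite ltr_pM2l // => zy2.
  have := ler_normD (z - y) (y - x); rewrite addrA subrK; lra.
have ex x : exists n, `[< good n (k n x) >].
  have [n [e e0 h]] := small x; exists n; apply/asboolP.
  by apply: h => //; rewrite subrr normr0.
(* The tile of [x] is the dyadic interval at the first good level. *)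
pose lev x := ex_minn (ex x).
have lev_good x : good (lev x) (k (lev x) x).
  by rewrite /lev; case: ex_minnP => n /asboolP.
have lev_le x n : good n (k n x) -> (lev x <= n)%N.
  by rewrite /lev; case: ex_minnP => m _ h g; apply: h; apply/asboolP.
have coarse m n x y : (m <= n)%N -> k n x = k n y -> k m x = k m y.
  move=> mn xy; apply/esym/kE; pose q : int := 2 ^+ (n - m).
  have qE : q%:~R = 2 ^+ (n - m) :> R by rewrite /q rmorphXn.
  have q0 : 0 < q%:~R :> R by rewrite ltr0z exprn_gt0.
  have qn (z : R) : 2 ^+ n * z = (2 ^+ m * z) * q%:~R.
    by rewrite qE [RHS]mulrAC -exprD subnKC.
  have [x1 x2] := andP (kP m x); apply/andP; split.
    rewrite -(ler_pM2r q0) -qn -intrM -floor_ge_int -/(k n y) -xy.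
    by rewrite floor_ge_int intrM qn ler_pM2r.
  rewrite -(ltr_pM2r q0) -qn -intrM -floor_lt_int -/(k n y) -xy.
  by rewrite floor_lt_int intrM qn ltr_pM2r.
have same x y : k (lev x) y = k (lev x) x -> lev y = lev x.
  move=> e; apply/eqP; rewrite eqn_leq lev_le ?e //=.
  rewrite leqNgt; apply/negP => lt.
  have := lev_le x (lev y); rewrite -(coarse _ _ _ _ (ltnW lt) e) => /(_ (lev_good y)).
  by rewrite leqNgt lt.
pose tile x := [set y : R | (k (lev x) x)%:~R < 2 ^+ lev x * y < (k (lev x) x + 1)%:~R].
(* [tile] is the open tile, so that a left endpoint is not in its own tile. *)
pose edge d := 2 ^+ lev d * d = (k (lev d) d)%:~R.
have tileE x y : tile x y -> lev y = lev x /\ k (lev x) y = k (lev x) x.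
  move=> /andP[y1 y2]; have e : k (lev x) y = k (lev x) x.
    by apply: kE; rewrite ltW.
  by split=> //; apply: same.
have isolated d : exists2 r, 0 < r &
    forall d', edge d -> edge d' -> `|d' - d| < r -> d' = d.
  have [n [e e0 h]] := small d.
  exists (Num.min e (2 ^- n)); first by rewrite lt_min e0 invr_gt0 p2.
  move=> d' ed ed'; rewrite lt_min => /andP[de dn].
  have grid y : edge y -> (lev y <= n)%N -> 2 ^+ n * y = (k n y)%:~R.
    move=> ey ly; have eq : 2 ^+ n * y = (k (lev y) y * 2 ^+ (n - lev y))%:~R.
      by rewrite intrM -ey rmorphXn [RHS]mulrAC -exprD subnKC.
    by rewrite eq; congr _%:~R; rewrite /k eq intrKfloor.
  have g' := grid _ ed' (lev_le _ _ (h n d' (leqnn n) de)).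
  have g : 2 ^+ n * d = (k n d)%:~R.
    by apply: grid => //; apply: lev_le; apply: h => //; rewrite subrr normr0.
  apply: (mulfI (lt0r_neq0 (p2 n))); rewrite g g'; congr _%:~R.
  have : `|2 ^+ n * d' - 2 ^+ n * d| < 1.
    by rewrite -mulrBr normrM gtr0_norm // mulrC -ltr_pdivlMr // div1r.
  rewrite g g' ltr_norml => /andP[d1 d2].
  apply/eqP; rewrite eq_le -!ltzD1 -!(ltr_int R) !intrD.
  by apply/andP; split; lra.
have neighbourhood d : exists r, [/\ 0 < r,
    forall d', edge d -> edge d' -> `|d' - d| < r -> d' = d &
    exists2 A, U A & ball d r `<=` A].
  have [A UA Ad] : exists2 A, U A & A d.
    by have : (\bigcup_(A in U) A) d by rewrite Ucov.
  have /(nbhs_ballP d)[e /= e0 eA] : nbhs d A.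
    by apply: open_nbhs_nbhs; split => //; exact: Uo.
  have [r r0 rP] := isolated d.
  exists (Num.min e r); split; first by rewrite lt_min e0.
    by move=> d' ed ed'; rewrite lt_min => /andP[_]; exact: rP.
  by exists A => //; apply: subset_trans eA; apply: le_ball; rewrite ge_min lexx.
have [r rP] := choice neighbourhood.
pose V0 := [set B | exists x, B = tile x].
pose V1 := [set B | exists2 d, edge d & B = ball d (r d / 2)].
exists (V0 `|` V1); split.
- split.
    move=> _ [[x ->]|[d _ ->]].
      have -> : tile x = (fun y => 2 ^+ lev x * y) @^-1`
          `](k (lev x) x)%:~R, (k (lev x) x + 1)%:~R[.
        by apply/seteqP; split=> y /=; rewrite in_itv.
      apply: open_comp => [y _|]; last exact: interval_open.
      by apply: cvgM; [exact: cvg_cst|exact: cvg_id].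
    by apply: ball_open; rewrite divr_gt0 //; case: (rP d).
  apply/seteqP; split => // z _.
  have [ez|ez] := pselect (edge z).
    exists (ball z (r z / 2)); first by right; exists z.
    by apply: ballxx; rewrite divr_gt0 //; case: (rP z).
  exists (tile z); first by left; exists z.
  have /andP[z1 z2] := kP (lev z) z; apply/andP; split => //.
  by rewrite lt_neqAle z1 andbT; apply/eqP => e; apply: ez.
- move=> _ [[x ->]|[d _ ->]].
    have [A UA cA] := lev_good x; exists A => //; apply: subset_trans cA.
    by move=> y /andP[y1 y2]; apply/andP; rewrite !ltW.
  have [r0 _ [A UA bA]] := rP d; exists A => //; apply: subset_trans bA.
  by apply: le_ball; rewrite ler_pdivrMr // ler_peMr // ?ltW // ltr1n.
- apply: disjoint_families_card.
    move=> _ _ z [x ->] [y ->] /tileE[lx kx] /tileE[ly ky].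
    by rewrite /tile -kx -ky -lx -ly.
  move=> _ _ z [d ed ->] [d' ed' ->] zd zd'.
  suff -> : d = d' by [].
  have [_ dP _] := rP d; have [_ d'P _] := rP d'.
  have dd : `|d' - d| < r d / 2 + r d' / 2.
    rewrite distrC; have := ball_triangle zd (ball_sym zd'); rewrite /ball /=.
    by [].
  have [rr|rr] := leP (r d) (r d').
    by apply: d'P => //; rewrite distrC; lra.
  by apply/esym/dP => //; lra.
Qed.

End Line.

(** * The moduli spaces as intervals *)

Local Open Scope quotient_scope.

Section Covdim.
Variables (R : realType) (M : topologicalType) (phi : M -> R) (s : R -> M).
Hypotheses (phi_cont : continuous phi) (s_cont : continuous s).

(** A covering of [M] is pulled back to the line, refined there, and the
    refinement is pulled back along [phi]. *)
Lemma covdim_le_retract : cancel phi s -> covdim_le M 1.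
Proof.
move=> K U [Uo Ucov].
have [|V [[Vo Vcov] VU Vord]] := @covdim_le_line R [set s @^-1` A | A in U].
  split; first by move=> _ [A UA <-]; apply: open_comp => [x _|]; [exact: s_cont|exact: Uo].
  apply/seteqP; split => // x _; have : (\bigcup_(A in U) A) (s x) by rewrite Ucov.
  by move=> [A UA Ax]; exists (s @^-1` A) => //; exists A.
exists [set phi @^-1` B | B in V]; split.
- split; first by move=> _ [B VB <-]; apply: open_comp => [x _|]; [exact: phi_cont|exact: Vo].
  apply/seteqP; split => // m _; have : (\bigcup_(B in V) B) (phi m) by rewrite Vcov.
  by move=> [B VB Bm]; exists (phi @^-1` B) => //; exists B.
- move=> _ [B VB <-]; have [_ [A UA <-] BA] := VU _ VB.
  by exists A => // m /BA /=; rewrite K.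
- move=> m; apply: card_le_trans (Vord (phi m)).
  apply: card_le_trans (card_image_le (fun B => phi @^-1` B) _).
  by apply: subset_card_le => _ [[B VB <-] Bm]; exists B.
Qed.

(** Covering [M] by two sets which each miss one of two points of a path, a
    refinement by disjoint sets would split the connected line. *)
Lemma covdim_gt0 (a b : R) : phi (s a) != phi (s b) -> ~ covdim_le M 0.
Proof.
wlog ab : a b / phi (s a) < phi (s b).
  move=> W; have [h|h|h] := ltgtP (phi (s a)) (phi (s b)) => // _.
    by apply: (W a b) => //; rewrite lt_eqF.
  by apply: (W b a) => //; rewrite lt_eqF.
move=> _ dim0.
pose U : set (set M) :=
  [set phi @^-1` [set y | y < phi (s b)]; phi @^-1` [set y | phi (s a) < y]].
have [|V [[Vo Vcov] VU Vord]] := dim0 U.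
  split.
    move=> _ [->|->]; apply: open_comp => [x _|]; try exact: phi_cont.
      exact: open_lt.
    exact: open_gt.
  apply/seteqP; split => // m _.
  have [h|h] := ltP (phi m) (phi (s b)).
    by exists (phi @^-1` [set y | y < phi (s b)]); first by left.
  exists (phi @^-1` [set y | phi (s a) < y]); first by right.
  exact: lt_le_trans h.
have [A VA Aa] : exists2 A, V A & A (s a).
  by have : (\bigcup_(A in V) A) (s a) by rewrite Vcov.
have disj B C x : V B -> V C -> B x -> C x -> B = C.
  by move=> VB VC Bx Cx; apply: (card_le1_eq (Vord x)).
have sA : s @^-1` A = setT.
  have co : connected (setT : set R) by apply/connected_intervalP => x y.
  apply: co.
  - by exists a.
  - by exists (s @^-1` A); [apply: open_comp => [x _|]; [exact: s_cont|exact: Vo]|rewrite setTI].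
  - exists (~` (s @^-1` \bigcup_(B in [set B | V B /\ B <> A]) B)).
      apply: open_closedC; apply: open_comp => [x _|]; first exact: s_cont.
      by apply: bigcup_open => B [VB _]; exact: Vo.
    rewrite setTI; apply/seteqP; split=> x /= xA.
      by move=> [B [VB BA] Bx]; apply: BA; exact: disj Bx xA.
    have [B VB Bx] : (\bigcup_(B in V) B) (s x) by rewrite Vcov.
    have [<- //|BA] := pselect (B = A).
    by case: xA; exists B.
have Ab : A (s b) by have : (s @^-1` A) b by rewrite sA.
have [B [->|->] AB] := VU _ VA.
  by have := AB _ Ab; rewrite /= ltxx.
by have := AB _ Aa; rewrite /= ltxx.
Qed.

End Covdim.

Section Continuity.
Variable R : realType.

Lemma continuous_mx (X : topologicalType) m n (f : X -> 'M[R]_(m, n)) :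
  (forall i j, continuous (fun x => f x i j)) -> continuous f.
Proof.
move=> h z A [P PM PA].
apply: (filterS (P := [set x | forall i j, P i j (f x i j)])).
  by move=> x Px; apply: PA.
apply: filter_forall => i; apply: filter_forall => j; exact: h (PM i j).
Qed.

Import ArrowAsProduct.

Lemma continuous_ptws (X : topologicalType) (I : eqType) (T : topologicalType)
    (f : X -> I -> T) :
  (forall i, continuous (fun x => f x i)) -> continuous f.
Proof.
move=> h z; apply/cvg_sup => i.
exact: (@continuous_comp_initial _ _ _ (@proj I (fun=> T) i) f (h i)).
Qed.

Lemma model_continuous (X : topologicalType) (rho : X -> R) :
  continuous rho -> continuous (fun u => model (rho u)).
Proof.
move=> rc; apply: continuous_ptws => x; apply: continuous_ptws => y.
apply: continuous_mx => i j.
pose c := cross x (im y).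
have -> : (fun u => model (rho u) x y i j) = (fun u =>
    glue (dot x (im y)) (y 0 (o4 0) *: x) 0 i j - rho u * glue 0 c 0 i j
    + Num.sqrt (1 - rho u * rho u) * glue 0 0 c i j).
  apply/funext => u.
  have -> : model (rho u) x y = glue (dot x (im y)) (y 0 (o4 0) *: x) 0
      + (- rho u) *: glue 0 c 0 + Num.sqrt (1 - rho u * rho u) *: glue 0 0 c.
    rewrite !glueZ !glueD /model expr2 !mulr0 !scaler0 !addr0 add0r.
    by rewrite scaleNr.
  by rewrite !mxE mulNr.
move=> u; apply: cvgD.
  apply: cvgB; first exact: cvg_cst.
  by apply: cvgM; [exact: rc|exact: cvg_cst].
apply: cvgM; last exact: cvg_cst.
apply: continuous_comp; last exact: sqrt_continuous.
by apply: cvgB; [exact: cvg_cst|apply: cvgM; exact: rc].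
Qed.

Section RealContinuous.
Variables (X : topologicalType) (f h : X -> R).
Hypotheses (fc : continuous f) (hc : continuous h).

Lemma continuous_addr : continuous (fun x => f x + h x).
Proof. by move=> x; apply: cvgD; [exact: fc|exact: hc]. Qed.

Lemma continuous_subr : continuous (fun x => f x - h x).
Proof. by move=> x; apply: cvgB; [exact: fc|exact: hc]. Qed.

Lemma continuous_mulr : continuous (fun x => f x * h x).
Proof. by move=> x; apply: cvgM; [exact: fc|exact: hc]. Qed.

End RealContinuous.

Lemma invariant_continuous : continuous (@invariant R).
Proof.
have ev x y (j : 'I_7) : continuous (fun F : mult34 R 7 => F x y 0 j).
  move=> F; apply: (@continuous_comp _ _ _ (fun F : mult34 R 7 => F x y) (fun v => v 0 j));
    last exact: coord_continuous.
  apply: (@continuous_comp _ _ _ (fun F : mult34 R 7 => F x) (fun v => v y)).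
    exact: (@proj_continuous 'rV[R]_3 (fun=> 'rV[R]_4 -> 'rV[R]_7) x).
  exact: (@proj_continuous 'rV[R]_4 (fun=> 'rV[R]_7) y).
have gr a b : continuous (fun F : mult34 R 7 => gram F (o3 0) (o3 1) a b).
  have -> : (fun F : mult34 R 7 => gram F (o3 0) (o3 1) a b) = (fun F => \sum_(j < 7)
      F (delta_mx 0 (o3 0)) (delta_mx 0 a) 0 j * F (delta_mx 0 (o3 1)) (delta_mx 0 b) 0 j).
    by apply/funext => F; rewrite gramE.
  apply: continuous_big; first exact: add_continuous.
  by move=> j _; apply: continuous_mulr; exact: ev.
apply: continuous_addr; first apply: continuous_subr.
- by apply: continuous_mulr; exact: gr.
- by apply: continuous_mulr; exact: gr.
- by apply: continuous_mulr; exact: gr.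
Qed.

End Continuity.

Section Moduli.
Variable R : realType.
Import ArrowAsProduct.

(** [kappa \o invariant] and [u |-> model (rho u)] induce a retraction of the line
    onto the moduli space; [rho] covers the values of the invariant on [S]. *)
Lemma moduli_covdim (S : set (mult34 R 7)) (rho kappa : R -> R) (a b : R) :
  S `<=` @orth_mult R 7 -> continuous rho ->
  (forall u, -1 <= rho u <= 1) -> (forall u, S (model (rho u))) ->
  (forall F, S F -> {for invariant F, continuous kappa}) ->
  (forall F, S F -> rho (kappa (invariant F)) = invariant F) ->
  kappa (rho a) != kappa (rho b) ->
  covdim_eq (moduli_of S) 1.
Proof.
move=> So rc r1 Sr kc rk kab.
pose g (F : S) : R := kappa (invariant (\val F)).
have SF (F : S) : S (\val F) by exact: set_valP.
have gc : continuous g.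
  move=> F; apply: (@continuous_comp _ _ _ (fun F : S => invariant (\val F)) kappa).
    apply: (@continuous_comp _ _ _ (fun F : S => \val F) (@invariant R)).
      exact: initial_continuous.
    exact: invariant_continuous.
  exact: kc.
pose Q := moduli_of S.
have gQ : {homo g : x y / \pi_Q x == \pi_Q y :> Q >-> x == y}.
  move=> F G /eqP/eqmodP/asboolP FG; apply/eqP; rewrite /g.
  by rewrite (invariant_equiv (So _ (SF F)) FG).
pose phi : Q -> R := g \o repr.
have phi_c : continuous phi by apply: repr_comp_continuous.
pose m u : S := exist _ (model (rho u)) (mem_set (Sr u)).
pose s u : Q := \pi_Q (m u).
have s_c : continuous s.
  move=> u; apply: (@continuous_comp _ _ _ m (\pi_Q)); last exact: pi_continuous.
  by apply: continuous_comp_initial; exact: model_continuous.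
have K : cancel phi s.
  move=> q; rewrite -[RHS]reprK; apply/eqmodP/asboolP => /=.
  rewrite /phi /= /g rk; last exact: SF.
  by apply: om_equiv_sym; apply: (normal_form _).2; exact: So (SF _).
have phis u : phi (s u) = kappa (rho u).
  have -> : phi (s u) = g (m u) by apply/eqP; apply: gQ; rewrite reprK.
  rewrite /g /= /invariant; have [_ _ ->] := model_gram (r1 u).
  by congr kappa; rewrite /pf !mxE /=; ring.
split; first exact: covdim_le_retract phi_c s_c K.
move=> [|//] _; apply: (covdim_gt0 phi_c s_c (a := a) (b := b)).
by rewrite !phis.
Qed.

Lemma norm_comp_continuous (f : R -> R) : continuous f -> continuous (fun u => `|f u|).
Proof. by move=> fc u; apply: continuous_comp; [exact: fc|exact: norm_continuous]. Qed.

(** Here [rho] is the retraction of the line onto [-1, 1]. *)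
Lemma moduli_dim : covdim_eq (moduli R 7) 1.
Proof.
pose rho (u : R) := (`|u + 1| - `|u - 1|) / 2.
have rhoE t : -1 <= t <= 1 -> rho t = t.
  by move=> /andP[t1 t2]; rewrite /rho ger0_norm ?ler0_norm; lra.
have r1 u : -1 <= rho u <= 1.
  have h1 := ler_distD; rewrite /rho.
  have := ler_dist_dist (u + 1) (u - 1).
  rewrite (_ : u + 1 - (u - 1) = 2); last by ring.
  by rewrite (ger0_norm (_ : 0 <= 2)) // ler_norml => /andP[*]; apply/andP; split; lra.
apply: (@moduli_covdim _ rho id 0 1) => //.
- apply: continuous_mulr; last exact: cst_continuous.
  by apply: continuous_subr; apply: norm_comp_continuous => v;
    apply: cvgD; try exact: cvg_id; exact: cvg_cst.
- by move=> u; exact: model_orth_mult.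
- by move=> F _; exact: cvg_id.
- by move=> F oF; exact: (rhoE _ (normal_form oF).1).
- have -> : rho 0 = 0 by apply: rhoE; apply/andP; split; lra.
  have -> : rho 1 = 1 by apply: rhoE; apply/andP; split; lra.
  by rewrite eq_sym oner_eq0.
Qed.

(** Here [rho] is a homeomorphism of the line onto the open interval. *)
Lemma full_moduli_dim : covdim_eq (full_moduli R 7) 1.
Proof.
pose rho (u : R) := u / (1 + `|u|); pose kappa (t : R) := t / (1 - `|t|).
have n0 (u : R) : 0 < 1 + `|u| by rewrite ltr_wpDr.
have nrho u : `|rho u| = `|u| / (1 + `|u|).
  by rewrite normrM normfV (gtr0_norm (n0 u)).
have rho1 u : -1 < rho u < 1.
  by rewrite -ltr_norml nrho ltr_pdivrMr // mul1r ltrDr.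
have kr u : kappa (rho u) = u.
  rewrite /kappa nrho /rho; field.
  by rewrite addrK oner_eq0 gt_eqF.
have rk t : -1 < t < 1 -> rho (kappa t) = t.
  rewrite -ltr_norml => t1.
  have t0 : 0 < 1 - `|t| by rewrite subr_gt0.
  rewrite /rho /kappa normrM normfV (gtr0_norm t0); field.
  by rewrite subrK oner_eq0 gt_eqF.
apply: (@moduli_covdim _ rho kappa 0 1).
- by move=> F [].
- move=> u; apply: cvgM; first exact: cvg_id.
  apply: cvgV; first by rewrite gt_eqF.
  by apply: cvgD; [exact: cvg_cst|exact: norm_continuous].
- by move=> u; have /andP[h1 h2] := rho1 u; rewrite !ltW.
- move=> u; split; last exact: model_full.
  by apply: model_orth_mult; have /andP[h1 h2] := rho1 u; rewrite !ltW.
- move=> F [oF fF]; have := full_invariant oF fF; rewrite -ltr_norml => t1.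
  apply: cvgM; first exact: cvg_id.
  apply: cvgV; first by rewrite gt_eqF // subr_gt0.
  by apply: cvgB; [exact: cvg_cst|exact: norm_continuous].
- by move=> F [oF fF]; apply: rk; exact: full_invariant.
- by rewrite !kr eq_sym oner_eq0.
Qed.

End Moduli.

Theorem mainTheorem5 (R : realType) :
  (forall F : mult34 R 7, orth_mult F -> full F ->
     (exists (A : 'M[R]_3) (B : 'M[R]_4),
        isSO A /\ isSO B /\ normalized F A B) /\
     (forall (A : 'M[R]_3) (B : 'M[R]_4),
        isO A -> isO B -> normalized F A B -> degenerate F A B)) /\
  covdim_eq (moduli R 7) 1 /\
  covdim_eq (full_moduli R 7) 1.
Proof.
split; last by split; [exact: moduli_dim | exact: full_moduli_dim].
move=> F oF _; split.
  by have [A [B [oA oB nF]]] := exists_normalized oF; exists A, B.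
by move=> A B oA oB; exact: normalized_degenerate.
Qed.
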